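(* Let $d\ge2$ be an integer and let $p,n$ be real with $p\ge n>d/2+1$. The sharp constant $G_{pn}$ has the bound $$G_{pn}\le G^{\langle+\rangle}_{pn},\qquad G^{\langle+\rangle}_{pn}:=\frac{2^p\,p}{(2\pi)^{d/2}}\sqrt{\zeta_{2n-2}},\qquad\zeta_{2n-2}:=\sum_{h\in\mathbf Z^d\setminus\{0\}}\frac1{|h|^{2n-2}}$$ (and $(G^{\langle+\rangle}_{pn})^{1/p}\to2$ for fixed $d,n$ and $p\to+\infty$).
   Context: Notation. $\mathbf T^d=(\mathbf R/2\pi\mathbf Z)^d$; $e_k(x)=(2\pi)^{-d/2}e^{ik\cdot x}$ for $k\in\mathbf Z^d$; $a\cdot b=\sum_ra_rb_r$ and $|a|=\sqrt{\overline a\cdot a}$ on $\mathbf C^d$; $\mathbf Z^d_0=\mathbf Z^d\setminus\{0\}$. An $\mathbf R^d$-valued distribution on $\mathbf T^d$ has a Fourier expansion $v=\sum_kv_ke_k$, $v_k=\overline{v_{-k}}\in\mathbf C^d$. For real $m$, $\mathbb H^m$ is the space of such $v$ with $k\cdot v_k=0$ for all $k$, $v_0=0$ and $\sum_{k\in\mathbf Z^d_0}|k|^{2m}|v_k|^2<\infty$, with inner product $\langle v|w\rangle_m=\sum_{k\in\mathbf Z^d_0}|k|^{2m}\overline{v_k}\cdot w_k$ and norm $\|v\|_m=\sqrt{\langle v|v\rangle_m}$. The Leray projection $\mathfrak L$ acts by $(\mathfrak Lv)_k=v_k-\frac{k\cdot v_k}{|k|^2}k$ for $k\ne0$, $(\mathfrak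 Lv)_0=v_0$. $\mathcal P(v,w)=\mathfrak L(v\cdot\partial w)$, $(v\cdot\partial w)_s=\sum_{r=1}^dv_r\partial_rw_s$; for $p>d/2$ it maps $\mathbb H^p\times\mathbb H^{p+1}$ to $\mathbb H^p$. For $p\ge n>d/2+1$, $G_{pn}$ is the sharp (i.e. minimum) constant $G$ such that $|\langle\mathcal P(v,w)|w\rangle_p|\le\frac12G(\|v\|_p\|w\|_n+\|v\|_n\|w\|_p)\|w\|_p$ for all $v\in\mathbb H^p$, $w\in\mathbb H^{p+1}$ (such constants exist). *)

(* Defs.v *)
From HB Require Import structures.
From mathcomp Require Import all_boot all_order all_algebra.
From mathcomp Require Import all_classical all_reals all_analysis.
From mathcomp Require Import complex.

Set Implicit Arguments.
Unset Strict Implicit.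
Unset Printing Implicit Defensive.

Import Order.TTheory GRing.Theory Num.Theory.
Import numFieldNormedType.Exports.

Local Open Scope classical_set_scope.
Local Open Scope ring_scope.
Local Open Scope complex_scope.

(* Distributions on T^d = (R / 2 pi Z)^d are represented by their Fourier
   coefficients: an R^d-valued distribution is a family
   v : 'rV[int]_d -> 'rV[R[i]]_d with v (- k) = conj (v k). *)

Section Euclidean.
Variables (R : realType) (d : nat).

Definition dot (K : pzRingType) (a b : 'rV[K]_d) : K :=
  \sum_(r < d) a 0 r * b 0 r.

Definition conjv (a : 'rV[R[i]]_d) : 'rV[R[i]]_d := map_mx (@conjc R) a.

Definition vnorm (a : 'rV[R[i]]_d) : R :=
  Num.sqrt (complex.Re (dot (conjv a) a)).

Definition zvec (k : 'rV[int]_d) : 'rV[R[i]]_d :=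
  map_mx (fun z : int => z%:~R) k.

Definition znorm (k : 'rV[int]_d) : R := vnorm (zvec k).

Definition Z0 : set 'rV[int]_d := [set k | k != 0].

End Euclidean.
Arguments zvec R {d} k.
Arguments znorm R {d} k.
Arguments Z0 {d}.

Section Sums.
Variables (R : realType) (I : choiceType).

(* Sums of absolutely summable families; nothing is claimed outside this
   case. *)
Definition rsum (D : set I) (f : I -> R) : R :=
  fine (\esum_(i in D) ((EFin \o f)^\+ i)%E) -
  fine (\esum_(i in D) ((EFin \o f)^\- i)%E).

Definition csum (D : set I) (f : I -> R[i]) : R[i] :=
  rsum D (fun i => complex.Re (f i)) +i* rsum D (fun i => complex.Im (f i)).

End Sums.

Section TorusIntegral.
Variable R : realType.

(* Integral over the period cell [0, 2 pi]^d, iterated over the coordinates. *)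
Fixpoint torus_rint (d : nat) : ('rV[R]_d -> R) -> R :=
  match d return ('rV[R]_d -> R) -> R with
  | 0%N => fun f => f 0
  | d'.+1 => fun f =>
      \int[@lebesgue_measure R]_(t in `[0, 2 * pi])
        torus_rint (fun x : 'rV[R]_d' => f (row_mx (t%:M : 'rV[R]_1) x))
  end.

Definition torus_int (d : nat) (f : 'rV[R]_d -> R[i]) : R[i] :=
  torus_rint (fun x => complex.Re (f x)) +i*
  torus_rint (fun x => complex.Im (f x)).

End TorusIntegral.

Section Sobolev.
Variables (R : realType) (d : nat).

Local Notation coefs := ('rV[int]_d -> R[i]).
Local Notation vcoefs := ('rV[int]_d -> 'rV[R[i]]_d).

(* (2 pi)^(- d / 2) exp (i k . x) *)
Definition fourier_e (k : 'rV[int]_d) (x : 'rV[R]_d) : R[i] :=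
  let t := dot (map_mx (fun z : int => z%:~R) k) x in
  ((2 * pi) `^ (- (d%:R / 2)))%:C * (cos t +i* sin t).

Definition fourier_series (f : coefs) (x : 'rV[R]_d) : R[i] :=
  csum setT (fun k => f k * fourier_e k x).

Definition fourier_coef (g : 'rV[R]_d -> R[i]) : coefs :=
  fun k => torus_int (fun x => conjc (fourier_e k x) * g x).

Definition HH (m : R) (v : vcoefs) : Prop :=
  [/\ forall k, v (- k) = conjv (v k),
      forall k, dot (zvec R k) (v k) = 0,
      v 0 = 0 &
      (\esum_(k in Z0) (znorm R k `^ (2 * m) * vnorm (v k) ^+ 2)%:E < +oo)%E].

Definition hdot (m : R) (v w : vcoefs) : R[i] :=
  csum Z0 (fun k => (znorm R k `^ (2 * m))%:C * dot (conjv (v k)) (w k)).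

Definition hnorm (m : R) (v : vcoefs) : R :=
  Num.sqrt (complex.Re (hdot m v v)).

Definition coord (v : vcoefs) (r : 'I_d) : coefs := fun k => v k 0 r.

Definition partial (r : 'I_d) (f : coefs) : coefs :=
  fun k => (0 +i* (k 0 r)%:~R) * f k.

(* The product v_r * d_r w_s is the pointwise one, so this is meaningful when
   v and the first derivatives of w have absolutely convergent Fourier
   series. *)
Definition advect (v w : vcoefs) : vcoefs := fun k =>
  \row_(s < d) fourier_coef (fun x => \sum_(r < d)
    fourier_series (coord v r) x * fourier_series (partial r (coord w s)) x) k.

Definition leray (v : vcoefs) : vcoefs := fun k =>
  if k == 0 then v k
  else v k - (dot (zvec R k) (v k) / (znorm R k ^+ 2)%:C) *: zvec R k.

Definition PP (v w : vcoefs) : vcoefs := leray (advect v w).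

Definition kato_constant (p n : R) (G : R) : Prop :=
  forall v w : vcoefs, HH p v -> HH (p + 1) w ->
    complex.Re `|hdot p (PP v w) w| <=
      1 / 2 * G * (hnorm p v * hnorm n w + hnorm n v * hnorm p w) * hnorm p w.

End Sobolev.

Section Constants.
Variables (R : realType) (d : nat).

(* That the infimum is a minimum is part of the theorem. *)
Definition Gsharp (p n : R) : R := inf [set G | kato_constant d p n G].

Definition zeta (s : R) : R :=
  fine (\esum_(h in @Z0 d) ((znorm R h `^ s)^-1)%:E).

Definition Gplus (p n : R) : R :=
  2 `^ p * p / (2 * pi) `^ (d%:R / 2) * Num.sqrt (zeta (2 * n - 2)).

End Constants.

(* Main.v *)
Require Import Defs.
From mathcomp Require Import all_boot all_order all_algebra.
From mathcomp Require Import all_classical all_reals all_analysis.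
From mathcomp Require Import complex ring lra.
Import Order.TTheory GRing.Theory Num.Theory.
Import numFieldNormedType.Exports.
Import Normc.
Local Open Scope classical_set_scope.
Local Open Scope ring_scope.
Set SsrOldRewriteGoalsOrder.

(** The Kato inequality is an estimate of a commutator. Write |D|^p for the Fourier
    multiplier |k|^p. The Leray projection drops out of <P(v,w)|w>_p, since w is
    divergence free, and so <P(v,w)|w>_p is the L^2 product of |D|^p (v . d w) with
    |D|^p w. As v is divergence free, the advection u -> v . d u is antisymmetric in
    L^2; hence v . d (|D|^p w) may be subtracted from the first factor at no cost,
    and only the commutator of |D|^p with v . d remains.

    In Fourier coefficients the product of v and the derivatives of w is a
    convolution ([fourier_coef_convolution], [advectE]), so the pairing is a
    sum over (k, h) of terms containing v_h, w_(k-h) and w_k. Splitting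
    |k|^(2 p) as |k|^p |k-h|^p + |k|^p (|k|^p - |k-h|^p) gives an antisymmetric part,
    which sums to zero ([dot_PP] and the involution (k, h) -> (h - k, h)), and the
    commutator part. For the latter, [powR_commutator] gives

      | |k|^p - |k-h|^p | <= p 2^(p-1) |h| (|h|^(p-1) + |k-h|^(p-1)),

    so that either v or w carries p derivatives and the other factor carries one. The
    factor with one derivative is placed in l1 and the two others in l2
    ([young_trilinear]); Cauchy-Schwarz bounds the l1 norm by the H^n norm times
    sqrt zeta_(2n-2), a convergent series because 2 n - 2 > d ([wt1_summable],
    [rsummable_zeta]). The product of the constants, with (2 pi)^(-d/2) from the
    convolution, is exactly half of G^<+> ([kato_estimate]).

    The sharp constant is the infimum of the admissible ones. These form a closed set,
    nonempty by the estimate and bounded below because of a nonzero test field,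
    so the infimum is attained ([kato_constant_inf], [kato_constant_ge0]). The limit
    follows from the form 2^p p c of the bound, with c > 0 independent of p: the p-th
    root of p c tends to 1 ([powR_root_cvg]). *)

(** * Absolutely convergent real sums *)

Section RealSums.
Set Implicit Arguments.
Unset Strict Implicit.
Unset Printing Implicit Defensive.
Variables (R : realType).
Implicit Types I J : choiceType.

Definition rsummable I (f : I -> R) := summable [set: I] (EFin \o f).

Lemma rsummable_le I (g f : I -> R) :
  rsummable g -> (forall i, `|f i| <= g i) -> rsummable f.
Proof.
move=> gs fg; apply: le_lt_trans gs; apply: le_esum => i _ /=.
by rewrite lee_fin (le_trans (fg i))// ler_norm.
Qed.

Lemma rsummableD I (f g : I -> R) :
  rsummable f -> rsummable g -> rsummable (fun i => f i + g i).
Proof. exact: summableD. Qed.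

Lemma rsummableN I (f : I -> R) :
  rsummable f -> rsummable (fun i => - f i).
Proof. by rewrite /rsummable (summableN _ (EFin \o f)). Qed.

Lemma esumZl_le I (a : I -> \bar R) (c : R) : 0 < c ->
  (forall i, 0 <= a i)%E ->
  (\esum_(i in [set: I]) (c%:E * a i) <= c%:E * \esum_(i in [set: I]) a i)%E.
Proof.
move=> c0 a0; apply: ge_ereal_sup => /= _ [X [finX _]] <-.
rewrite fsbig_finite//= -ge0_sume_distrr//.
rewrite lee_pmul2l// -fsbig_finite//.
by apply: ereal_sup_ubound; exists X.
Qed.

Lemma esumZl I (a : I -> \bar R) (c : R) : 0 < c ->
  (forall i, 0 <= a i)%E ->
  (\esum_(i in [set: I]) (c%:E * a i) = c%:E * \esum_(i in [set: I]) a i)%E.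
Proof.
move=> c0 a0; apply/eqP; rewrite eq_le esumZl_le//=.
rewrite -(@lee_pmul2l _ c^-1%:E)// ?lte_fin ?invr_gt0//.
rewrite muleA -EFinM mulVf ?gt_eqF// mul1e.
apply: le_trans (esumZl_le _ _); rewrite ?invr_gt0//; last first.
  by move=> i; rewrite mule_ge0// lee_fin ltW.
by apply: le_esum => i _; rewrite muleA -EFinM mulVf ?gt_eqF// mul1e.
Qed.

Lemma rsummableZ I (f : I -> R) c :
  rsummable f -> rsummable (fun i => c * f i).
Proof.
have [->|c0] := eqVneq c 0.
  by move=> _; rewrite /rsummable /summable esum1// => i _ /=; rewrite mul0r normr0.
rewrite /rsummable /summable => fs.
under eq_esum do rewrite /= normrM EFinM.
rewrite esumZl ?normr_gt0//.
by rewrite lte_mul_pinfty// lee_fin.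
Qed.

(** Turns identities and bounds between nonnegative sums into statements
    about [esum], where Tonelli and reindexing are available without
    summability conditions. *)
Lemma rsum_esum I (f : I -> R) : (forall i, 0 <= f i) -> rsummable f ->
  (rsum setT f)%:E = \esum_(i in [set: I]) (f i)%:E.
Proof.
move=> f0; rewrite /rsum.
rewrite (_ : \esum_(i in _) ((EFin \o f)^\- i)%E = 0%E); last first.
  by apply: esum1 => i _; rewrite funenegE; apply/max_idPr; rewrite /= lee_fin oppr_le0.
rewrite (_ : \esum_(i in _) ((EFin \o f)^\+ i)%E = \esum_(i in [set: I]) (f i)%:E); last first.
  by apply: eq_esum => i _; rewrite funeposE; apply/max_idPl; rewrite /= lee_fin.
move=> fs; rewrite /= subr0 fineK// ge0_fin_numE; last first.
  by apply: esum_ge0 => i _; rewrite lee_fin.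
by apply: le_lt_trans fs; apply: le_esum => i _; rewrite lee_fin ler_norm.
Qed.

(** Linearity of [rsum] rests on this: the value does not depend on the
    decomposition of a summable family as a difference of two nonnegative ones,
    and the canonical decompositions of f and g add up to one of f + g. *)
Lemma rsum_subE I (f g : I -> R) : (forall i, 0 <= f i) -> (forall i, 0 <= g i) ->
  rsummable f -> rsummable g ->
  rsum setT (fun i => f i - g i) = rsum setT f - rsum setT g.
Proof.
move=> f0 g0 fs gs; apply: EFin_inj; rewrite [RHS]EFinB (rsum_esum f0)// (rsum_esum g0)//.
rewrite -(esumB fs gs) => [|i _|i _]; rewrite ?lee_fin//.
rewrite /rsum EFinB !fineK//.
  rewrite ge0_fin_numE; last by apply: esum_ge0.
  by have := summable_funeneg (summableB fs gs); apply: le_lt_trans;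
     apply: le_esum => i _; rewrite gee0_abs.
rewrite ge0_fin_numE; last by apply: esum_ge0.
by have := summable_funepos (summableB fs gs); apply: le_lt_trans;
   apply: le_esum => i _; rewrite gee0_abs.
Qed.

Lemma rsum_ge0 I (f : I -> R) : (forall i, 0 <= f i) -> 0 <= rsum setT f.
Proof.
move=> f0; rewrite /rsum [X in _ - fine X]esum1 ?subr0; last first.
  by move=> i _; rewrite funenegE; apply/max_idPr; rewrite /= lee_fin oppr_le0.
by rewrite fine_ge0// esum_ge0.
Qed.

Lemma le_term_rsum I (f : I -> R) : (forall i, 0 <= f i) -> rsummable f ->
  forall i, f i <= rsum setT f.
Proof.
move=> f0 fs i; rewrite -lee_fin rsum_esum//; apply: esum_ge.
by exists [set i]; [split|rewrite fsbig_set1].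
Qed.

Lemma rsumD_ge0 I (f g : I -> R) : (forall i, 0 <= f i) -> (forall i, 0 <= g i) ->
  rsummable f -> rsummable g ->
  rsum setT (fun i => f i + g i) = rsum setT f + rsum setT g.
Proof.
move=> f0 g0 fs gs; apply: EFin_inj; rewrite [RHS]EFinD !rsum_esum//.
- by rewrite -esumD// => i _; rewrite lee_fin.
- by move=> i; rewrite addr_ge0.
- exact: rsummableD.
Qed.

Lemma maxrN0 (x : R) : x = Num.max x 0 - Num.max (- x) 0.
Proof.
have [x0|x0] := leP 0 x.
  by rewrite (max_idPr _) ?subr0// oppr_le0.
by rewrite (max_idPl _) ?opprK ?add0r // oppr_ge0 ltW.
Qed.

Lemma rsum_eq I (f g : I -> R) : f =1 g -> rsum setT f = rsum setT g.
Proof. by move=> /funext ->. Qed.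

Lemma rsummable_pos I (f : I -> R) : rsummable f -> rsummable (fun i => Num.max (f i) 0).
Proof.
move=> fs; apply: (rsummable_le (g := fun i => `|f i|)).
  by have := fs; rewrite /rsummable /summable; under eq_esum do rewrite /= -normr_id.
move=> i; rewrite ger0_norm ?le_max ?lexx ?orbT// ge_max ler_norm/= normr_ge0//.
Qed.

Lemma rsummable_neg I (f : I -> R) : rsummable f -> rsummable (fun i => Num.max (- f i) 0).
Proof. by move/rsummableN/rsummable_pos. Qed.

Lemma rsum_posneg I (f : I -> R) : rsummable f ->
  rsum setT f = rsum setT (fun i => Num.max (f i) 0) - rsum setT (fun i => Num.max (- f i) 0).
Proof.
move=> fs; rewrite -rsum_subE//.
- by apply: rsum_eq => i; rewrite -maxrN0.
- by move=> i; rewrite le_max lexx orbT.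
- by move=> i; rewrite le_max lexx orbT.
- exact: rsummable_pos.
- exact: rsummable_neg.
Qed.

Lemma rsumD I (f g : I -> R) : rsummable f -> rsummable g ->
  rsum setT (fun i => f i + g i) = rsum setT f + rsum setT g.
Proof.
move=> fs gs; rewrite (rsum_posneg fs) (rsum_posneg gs).
have m0 (h : I -> R) : forall i, 0 <= Num.max (h i) 0 by move=> i; rewrite le_max lexx orbT.
have fp := rsummable_pos fs; have gp := rsummable_pos gs.
have fn := rsummable_neg fs; have gn := rsummable_neg gs.
have m0' (h : I -> R) : forall i, 0 <= Num.max (- h i) 0 by move=> i; rewrite le_max lexx orbT.
rewrite addrACA -opprD -rsumD_ge0// -rsumD_ge0// -rsum_subE; last 4 first.
- by move=> i; rewrite addr_ge0.
- by move=> i; rewrite addr_ge0.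
- exact: rsummableD.
- exact: rsummableD.
by apply: rsum_eq => i; rewrite opprD addrACA -!maxrN0.
Qed.

Lemma rsum0 I : rsum setT (fun i : I => 0 : R) = 0.
Proof.
rewrite /rsum !esum1 ?subrr// => i _.
  by rewrite funenegE/= oppr0 maxxx.
by rewrite funeposE/= maxxx.
Qed.

Lemma rsummable0 I : rsummable (fun i : I => 0 : R).
Proof. by rewrite /rsummable /summable esum1// => i _ /=; rewrite normr0. Qed.

Lemma rsumN I (f : I -> R) : rsummable f ->
  rsum setT (fun i => - f i) = - rsum setT f.
Proof.
move=> fs; apply/eqP; rewrite -addr_eq0 -rsumD//; last exact: rsummableN.
by rewrite (@rsum_eq _ _ (fun=> 0)) ?rsum0// => i; rewrite addNr.
Qed.

Lemma rsumZ I (f : I -> R) c : rsummable f ->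
  rsum setT (fun i => c * f i) = c * rsum setT f.
Proof.
move=> fs.
have ge0 (g : I -> R) b : rsummable g -> (forall i, 0 <= g i) -> 0 < b ->
    rsum setT (fun i => b * g i) = b * rsum setT g.
  move=> gs g0 b0; apply: EFin_inj; rewrite EFinM !rsum_esum//; last first.
  - exact: rsummableZ.
  - by move=> i; rewrite mulr_ge0 // ltW.
  by rewrite -esumZl// => i; rewrite lee_fin.
have gt0 (b : R) : 0 < b -> rsum setT (fun i => b * f i) = b * rsum setT f.
  move=> b0; rewrite (rsum_posneg fs) mulrBr -!ge0//;
    try by [exact: rsummable_pos|exact: rsummable_neg|move=> i; rewrite le_max lexx orbT].
  rewrite -rsum_subE//; try by [apply: rsummableZ; exact: rsummable_pos|
    apply: rsummableZ; exact: rsummable_neg|move=> i; rewrite mulr_ge0 ?(ltW b0)// le_max lexx orbT].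
  by apply: rsum_eq => i; rewrite -mulrBr -maxrN0.
have [c0|c0|->] := ltgtP c 0; last first.
- by rewrite mul0r (@rsum_eq _ _ (fun=> 0)) ?rsum0// => i; rewrite mul0r.
- exact: gt0.
- rewrite -[c]opprK mulNr -gt0 ?oppr_gt0// -rsumN; last exact: rsummableZ.
  by apply: rsum_eq => i; rewrite -mulNr.
Qed.

Lemma le_rsum I (f g : I -> R) : rsummable f -> rsummable g ->
  (forall i, f i <= g i) -> rsum setT f <= rsum setT g.
Proof.
move=> fs gs fg; rewrite -subr_ge0 -rsumN// -rsumD//; last exact: rsummableN.
by apply: rsum_ge0 => i; rewrite subr_ge0.
Qed.

Lemma rsummable_abs I (f : I -> R) : rsummable f -> rsummable (fun i => `|f i|).
Proof. by rewrite /rsummable /summable => fs; under eq_esum do rewrite /= normr_id. Qed.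

Lemma ler_norm_rsum I (f g : I -> R) : rsummable g -> (forall i, `|f i| <= g i) ->
  `|rsum setT f| <= rsum setT g.
Proof.
move=> gs fg; have fs := rsummable_le gs fg.
rewrite ler_norml -rsumN// !le_rsum//; last 2 first.
- exact: rsummableN.
- by move=> i; rewrite lerNl (le_trans _ (fg i))// -normrN ler_norm.
- by move=> i; rewrite (le_trans _ (fg i))// ler_norm.
Qed.

Lemma rsum_reindex I J (e : I -> J) (f : J -> R) : bijective e ->
  rsum setT f = rsum setT (fun i => f (e i)).
Proof.
move=> [e' ee' e'e]; have be : set_bij [set: I] [set: J] e.
  split => //; first by move=> x y _ _ /(congr1 e'); rewrite !ee'.
  by move=> y _; exists (e' y).
by rewrite /rsum !(reindex_esum _ _ _ _ be); congr (fine _ - fine _);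
  apply: eq_esum => i _; rewrite ?funeposE ?funenegE.
Qed.

Lemma rsummable_reindex I J (e : I -> J) (f : J -> R) : bijective e ->
  rsummable f -> rsummable (fun i => f (e i)).
Proof.
move=> [e' ee' e'e]; have be : set_bij [set: I] [set: J] e.
  split => //; first by move=> x y _ _ /(congr1 e'); rewrite !ee'.
  by move=> y _; exists (e' y).
by rewrite /rsummable /summable !(reindex_esum _ _ _ _ be).
Qed.

Lemma esum_pairE I J (a : I * J -> \bar R) : (forall z, 0 <= a z)%E ->
  \esum_(z in [set: I * J]) a z = \esum_(i in [set: I]) \esum_(j in [set: J]) a (i, j).
Proof.
move=> a0; rewrite (_ : [set: I * J] = [set: I] `*`` (fun=> [set: J])); last by apply/seteqP; split.
by rewrite (@esum_esum _ _ _ _ _ (fun i j => a (i, j)))//; apply: eq_esum => -[].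
Qed.

Lemma rsummable_row I J (f : I * J -> R) : rsummable f ->
  forall i, rsummable (fun j => f (i, j)).
Proof.
move=> fs i; apply: le_lt_trans fs.
rewrite esum_pairE//.
apply: esum_ge; exists [set i]; first by split.
by rewrite fsbig_set1.
Qed.

Lemma rsummable_rsum I J (f : I * J -> R) : rsummable f ->
  rsummable (fun i => rsum setT (fun j => f (i, j))).
Proof.
move=> fs; apply: le_lt_trans (fs).
rewrite esum_pairE//; apply: le_esum => i _.
rewrite -rsum_esum => //.
  rewrite lee_fin; apply: ler_norm_rsum => //; apply: rsummable_abs.
  exact: (rsummable_row fs i).
apply: rsummable_abs; exact: (rsummable_row fs i).
Qed.

(** Tonelli as a summability criterion: iterated bounds give a bound over
    pairs, which is the form in which [rsum_fubini] applies. *)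
Lemma rsummable_pair I J (f : I * J -> R) (g : I -> R) :
  (forall i, rsummable (fun j => f (i, j))) ->
  rsummable g -> (forall i, rsum setT (fun j => `|f (i, j)|) <= g i) ->
  rsummable f.
Proof.
move=> fs gs fg; rewrite /rsummable /summable.
rewrite esum_pairE//.
apply: le_lt_trans gs; apply: le_esum => i _.
rewrite -rsum_esum => //; last exact: rsummable_abs.
by rewrite lee_fin (le_trans (fg i))// ler_norm.
Qed.

Lemma rsum_fubini_ge0 I J (f : I * J -> R) : (forall z, 0 <= f z) -> rsummable f ->
  rsum setT (fun i => rsum setT (fun j => f (i, j))) = rsum setT f.
Proof.
move=> f0 fs; apply: EFin_inj; rewrite !rsum_esum//; last 2 first.
- by move=> i; apply: rsum_ge0.
- exact: rsummable_rsum.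
rewrite esum_pairE; last by move=> z; rewrite lee_fin.
by apply: eq_esum => i _; rewrite rsum_esum//; exact: rsummable_row.
Qed.

Lemma rsum_fubini I J (f : I * J -> R) : rsummable f ->
  rsum setT (fun i => rsum setT (fun j => f (i, j))) = rsum setT f.
Proof.
move=> fs; rewrite (rsum_posneg fs).
have p := rsummable_pos fs; have n := rsummable_neg fs.
rewrite -!rsum_fubini_ge0//; try by move=> i; rewrite le_max lexx orbT.
rewrite -rsum_subE; [|move=> i; apply: rsum_ge0 => j; rewrite le_max lexx orbT//..| | ].
- by apply: rsum_eq => i; rewrite rsum_posneg//; apply: rsummable_row fs i.
- exact: (rsummable_rsum (f := fun z => Num.max (f z) 0)).
- exact: (rsummable_rsum (f := fun z => Num.max (- f z) 0)).
Qed.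

(** A finite sum is an [rsum] of a family cut off to the finite set, so that
    the difference between a sum and a partial sum is again an [rsum]. *)
Lemma rsum_fset_mask I (A : seq I) (f : I -> R) : uniq A ->
  rsummable (fun i => if i \in A then f i else 0) /\
  rsum setT (fun i => if i \in A then f i else 0) = \sum_(i <- A) f i.
Proof.
elim: A => [_|a A ih /= /andP[aA uA]].
  by rewrite big_nil; split; [exact: rsummable0|exact: rsum0].
have single : rsummable (fun i => if i == a then f i else 0) /\
    rsum setT (fun i => if i == a then f i else 0) = f a.
  have pos (g : I -> R) : (forall i, 0 <= g i) -> \esum_(i in [set: I]) (if i == a then g i else 0)%:E = (g a)%:E.
    move=> g0; rewrite (eq_esum (b := fun i => if i \in [set a] then (g i)%:E else 0%E)).
      by rewrite -esum_mkcond esum_set1 ?lee_fin.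
    by move=> i _; case: eqVneq => [->|/eqP ia]; [rewrite mem_set|rewrite memNset].
  split.
    rewrite /rsummable /summable.
    rewrite (eq_esum (b := fun i => (if i == a then `|f i| else 0)%:E)) ?pos ?ltry//.
    by move=> i _ /=; case: ifP; rewrite ?normr0.
  rewrite /rsum (eq_esum (b := fun i => (if i == a then Num.max (f i) 0 else 0)%:E)) ?pos; last first.
  - by move=> i _ /=; rewrite funeposE /= -EFin_max; case: ifP; rewrite // maxxx.
  - by move=> i; rewrite le_max lexx orbT.
  rewrite (eq_esum (b := fun i => (if i == a then Num.max (- f i) 0 else 0)%:E)) ?pos/= -?maxrN0//.
  - by move=> i; rewrite le_max lexx orbT.
  - by move=> i _ /=; rewrite funenegE /= -EFin_max; case: ifP; rewrite // oppr0 maxxx.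
have [ih1 ih2] := ih uA; case: single => s1 s2.
have -> : (fun i => if i \in a :: A then f i else 0) =
    (fun i => (if i == a then f i else 0) + (if i \in A then f i else 0)).
  apply/funext => i; rewrite in_cons; case: eqP => [->|_] /=; last by rewrite add0r.
  by rewrite (negbTE aA) addr0.
by rewrite rsumD// s2 ih2 big_cons; split => //; exact: rsummableD.
Qed.

(** One finite set serves all families dominated by b at once. For families
    of functions this makes the partial sums converge uniformly, which is what
    the exchange with the torus integral needs. *)
Lemma rsum_approx I (b : I -> R) : rsummable b -> forall e : R, 0 < e ->
  exists2 A : seq I, uniq A & forall f : I -> R, (forall i, `|f i| <= b i) ->
    `|rsum setT f - \sum_(i <- A) f i| <= e.
Proof.
move=> bs e e0; have [b0|/existsNP[i0 b0]] := pselect (forall i, 0 <= b i); last first.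
  exists [::] => // f fb; exfalso; apply: b0; exact: le_trans (fb i0).
have bE := rsum_esum b0 bs.
have : ((rsum setT b - e)%:E < \esum_(i in [set: I]) (b i)%:E)%E.
  by rewrite -bE lte_fin ltrBlDr ltrDl.
move=> /ereal_sup_gt[_ [X [finX _] <-]].
rewrite fsbig_finite//= sumEFin lte_fin.
have := finmap.fset_uniq (fset_set X); move: (finmap.enum_fset _) => A uA bX.
exists A => //.
move=> f fb.
have fs : rsummable f by exact: rsummable_le fb.
have [fA1 fA2] := rsum_fset_mask f uA.
have [bA1 bA2] := rsum_fset_mask b uA.
rewrite -fA2 -rsumN// -rsumD//; last exact: rsummableN.
apply: (@le_trans _ _ (rsum setT b - \sum_(i <- A) b i)).
  rewrite -bA2 -rsumN// -rsumD//; last exact: rsummableN.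
  apply: ler_norm_rsum; first by apply: rsummableD => //; exact: rsummableN.
  by move=> i; case: ifP => _; rewrite ?subrr ?normr0// !subr0.
by rewrite lerBlDr -lerBlDl ltW.
Qed.

End RealSums.

(** * Absolutely convergent complex sums *)

Section ComplexSums.
Set Implicit Arguments.
Unset Strict Implicit.
Unset Printing Implicit Defensive.
Variables (R : realType).
Implicit Types I J : choiceType.
Local Open Scope complex_scope.
Local Notation C := R[i].
Local Notation Re := complex.Re.
Local Notation Im := complex.Im.

Lemma normcE_Re (z : C) : normc z = Re `|z|.
Proof. by rewrite normc_def; case: z. Qed.

Lemma normc_ge0 (z : C) : 0 <= normc z.
Proof. by case: z => a b; exact: sqrtr_ge0. Qed.

Lemma normcJ' (z : C) : normc (conjc z) = normc z.
Proof. by case: z => a b; rewrite /= sqrrN. Qed.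

Lemma normcR (x : R) : normc x%:C = `|x|.
Proof. by rewrite /= expr0n addr0 sqrtr_sqr. Qed.

Lemma Re_le_normc (z : C) : `|Re z| <= normc z.
Proof. by case: z => a b /=; rewrite -sqrtr_sqr ler_wsqrtr// lerDl sqr_ge0. Qed.

Lemma Im_le_normc (z : C) : `|Im z| <= normc z.
Proof. by case: z => a b /=; rewrite -(sqrtr_sqr b) ler_wsqrtr// lerDr sqr_ge0. Qed.

Lemma normc_le_ReIm (z : C) : normc z <= `|Re z| + `|Im z|.
Proof.
case: z => a b /=; rewrite -[leRHS]ger0_norm ?addr_ge0// -sqrtr_sqr ler_wsqrtr//.
rewrite sqrrD !real_normK ?num_real// addrAC lerDl mulrn_wge0// mulr_ge0//.
Qed.

Definition csummable I (f : I -> C) := rsummable (fun i => normc (f i)).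

Lemma csummable_Re I (f : I -> C) : csummable f -> rsummable (fun i => Re (f i)).
Proof. by move=> fs; apply: rsummable_le fs _ => i; exact: Re_le_normc. Qed.

Lemma csummable_Im I (f : I -> C) : csummable f -> rsummable (fun i => Im (f i)).
Proof. by move=> fs; apply: rsummable_le fs _ => i; exact: Im_le_normc. Qed.

Lemma csummable_le I (g : I -> R) (f : I -> C) :
  rsummable g -> (forall i, normc (f i) <= g i) -> csummable f.
Proof.
move=> gs fg; apply: rsummable_le gs _ => i.
by rewrite ger0_norm ?normc_ge0.
Qed.

Lemma csummableD I (f g : I -> C) : csummable f -> csummable g ->
  csummable (fun i => f i + g i).
Proof.
move=> fs gs; apply: csummable_le (rsummableD fs gs) _ => i.
exact: le_normcD.
Qed.

Lemma csummableZ I (f : I -> C) c : csummable f -> csummable (fun i => c * f i).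
Proof.
move=> fs; apply: csummable_le (rsummableZ (normc c) fs) _ => i.
by rewrite normcM.
Qed.

Lemma csum_eq I (f g : I -> C) : f =1 g -> csum setT f = csum setT g.
Proof. by move=> /funext ->. Qed.

Lemma csumD I (f g : I -> C) : csummable f -> csummable g ->
  csum setT (fun i => f i + g i) = csum setT f + csum setT g.
Proof.
move=> fs gs; rewrite /csum; congr Complex.
  rewrite -rsumD; try exact: csummable_Re.
  by apply: rsum_eq => i; case: (f i) (g i) => [? ?] [].
rewrite -rsumD; try exact: csummable_Im.
by apply: rsum_eq => i; case: (f i) (g i) => [? ?] [].
Qed.

Lemma csumZ I (f : I -> C) c : csummable f ->
  csum setT (fun i => c * f i) = c * csum setT f.
Proof.
move=> fs; have fr := csummable_Re fs; have fi := csummable_Im fs.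
case: c => a b; rewrite /csum; congr Complex.
  rewrite -rsumZ// -rsumZ// -rsumN ?rsumD; try exact: rsummableZ.
  rewrite -rsumD; [|exact: rsummableZ|apply: rsummableN; exact: rsummableZ].
  by apply: rsum_eq => i; case: (f i).
rewrite -rsumZ// -rsumZ// -rsumD; try exact: rsummableZ.
by apply: rsum_eq => i; case: (f i).
Qed.

Lemma csum0 I : csum setT (fun i : I => 0 : C) = 0.
Proof. by rewrite /csum rsum0. Qed.

Lemma csummable0 I : csummable (fun i : I => 0 : C).
Proof. by rewrite /csummable; under eq_fun do rewrite normc0; exact: rsummable0. Qed.

Lemma csumN I (f : I -> C) : csummable f ->
  csum setT (fun i => - f i) = - csum setT f.
Proof.
move=> fs; rewrite -mulN1r -csumZ//.
by apply: csum_eq => i; rewrite mulN1r.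
Qed.

Lemma csum_conj I (f : I -> C) : csummable f ->
  csum setT (fun i => conjc (f i)) = conjc (csum setT f).
Proof.
move=> fs; rewrite /csum /=; congr Complex.
  by apply: rsum_eq => i; case: (f i).
rewrite -rsumN; last exact: csummable_Im.
by apply: rsum_eq => i; case: (f i).
Qed.

Lemma csummable_conj I (f : I -> C) : csummable f -> csummable (fun i => conjc (f i)).
Proof. by move=> fs; apply: csummable_le fs _ => i; rewrite normcJ'. Qed.

Lemma csum_sum I (T : finType) (f : T -> I -> C) :
  (forall t, csummable (f t)) ->
  csummable (fun i => \sum_t f t i) /\
  csum setT (fun i => \sum_t f t i) = \sum_t csum setT (f t).
Proof.
move=> fs; elim: (index_enum T) => [|t s [ih1 ih2]].
  split; first by under eq_fun do rewrite big_nil; exact: csummable0.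
  by rewrite big_nil; under eq_fun do rewrite big_nil; exact: csum0.
split; first by under eq_fun do rewrite big_cons; exact: csummableD.
by rewrite big_cons; under eq_fun do rewrite big_cons; rewrite csumD// ih2.
Qed.

Lemma csum_reindex I J (e : I -> J) (f : J -> C) : bijective e ->
  csum setT f = csum setT (fun i => f (e i)).
Proof.
by move=> be; rewrite /csum (rsum_reindex _ be) (rsum_reindex (fun j => Im (f j)) be).
Qed.

Lemma csum_fubini I J (f : I * J -> C) : csummable f ->
  csum setT (fun i => csum setT (fun j => f (i, j))) = csum setT f.
Proof.
move=> fs; rewrite /csum /= (rsum_fubini (f := fun z => Re (f z))); last exact: csummable_Re.
by rewrite (rsum_fubini (f := fun z => Im (f z)))//; exact: csummable_Im.
Qed.

Lemma csummable_csum I J (f : I * J -> C) : csummable f ->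
  csummable (fun i => csum setT (fun j => f (i, j))).
Proof.
move=> fs; apply: (@csummable_le _ (fun i => `|rsum setT (fun j => Re (f (i, j)))| +
    `|rsum setT (fun j => Im (f (i, j)))|)); last by move=> i; exact: normc_le_ReIm.
apply: rsummableD; apply: rsummable_abs.
  exact: (rsummable_rsum (csummable_Re fs)).
exact: (rsummable_rsum (csummable_Im fs)).
Qed.

(** Extends sums over the nonzero frequencies to all of them: the summands
    met below vanish at frequency zero. *)
Lemma csum_masked I (D : set I) (f : I -> C) :
  (forall i, ~ D i -> f i = 0) -> csum D f = csum setT f.
Proof.
move=> f0; rewrite /csum /rsum; congr Complex; congr (fine _ - fine _);
  rewrite esum_mkcond; apply: eq_esum => i _; case: (asboolP (D i)) => Di;
  rewrite ?(mem_set Di)// (memNset Di) ?funeposE ?funenegE /= f0//= ?oppr0 maxxx//.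
Qed.

Lemma csum_single I (a : I) (f : I -> C) : (forall i, i != a -> f i = 0) ->
  csum setT f = f a.
Proof.
move=> f0; have [_ h] := rsum_fset_mask (fun i => Re (f i)) (A := [:: a]) isT.
have [_ h'] := rsum_fset_mask (fun i => Im (f i)) (A := [:: a]) isT.
move: h h'; rewrite !big_seq1 => h h'; rewrite /csum [RHS]complexE.
transitivity (Re (f a) +i* Im (f a)); last by rewrite [LHS]complexE.
congr Complex; [rewrite -h|rewrite -h']; apply: rsum_eq => i;
  rewrite mem_seq1; case: eqVneq => // /f0 -> //.
Qed.

(** Rotating the sum onto the positive real axis reduces the complex triangle
    inequality to the real one. *)
Lemma normc_csum_le I (g : I -> R) (f : I -> C) :
  rsummable g -> (forall i, normc (f i) <= g i) ->
  normc (csum setT f) <= rsum setT g.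
Proof.
move=> gs fg; have fs := csummable_le gs fg.
set S := csum setT f.
have g0 : 0 <= rsum setT g by apply: rsum_ge0 => i; apply: le_trans (fg i); exact: normc_ge0.
have [->|S0] := eqVneq S 0; first by rewrite normc0.
have nS : 0 < normc S.
  rewrite lt_def normc_ge0 andbT; apply: contra S0 => /eqP /eq0_normc -> //.
(* A unimodular factor with u S = |S|. *)
pose u := conjc S * (normc S)^-1%:C.
have nu : normc u = 1.
  by rewrite normcM normcJ' normcR ger0_norm ?invr_ge0 ?normc_ge0// mulfV ?gt_eqF.
have uS : Re (u * S) = normc S.
  have -> : u * S = ((normc S) ^+ 2)%:C * (normc S)^-1%:C.
    rewrite /u mulrAC; congr (_ * _); rewrite mulrC -sqr_normc.
    by rewrite normc_def -rmorphXn /=; case: (S).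
  by rewrite -rmorphM/= expr2 mulfK ?gt_eqF.
rewrite -uS -csumZ// /csum /=.
apply: le_trans (ler_norm _) _; apply: ler_norm_rsum => // i.
by apply: le_trans (Re_le_normc _) _; rewrite normcM nu mul1r.
Qed.

End ComplexSums.

(** * Cauchy-Schwarz, Young and power inequalities *)

Section Inequalities.
Set Implicit Arguments.
Unset Strict Implicit.
Unset Printing Implicit Defensive.
Variables (R : realType).

(** Both Cauchy-Schwarz inequalities below come from this: sum the weighted
    arithmetic-geometric inequality termwise, then choose the weight
    sqrt (B / A), with a separate treatment of A = 0 and B = 0. *)
Lemma weighted_amgm_optimum (S A B : R) : 0 <= A -> 0 <= B ->
  (forall t, 0 < t -> 2 * S <= t * A + t^-1 * B) ->
  S <= Num.sqrt A * Num.sqrt B.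
Proof.
move=> A0 B0 H; have [S0|S0] := leP S 0.
  by rewrite (le_trans S0)// mulr_ge0 ?sqrtr_ge0.
have {}A0 : 0 < A.
  rewrite lt_neqAle A0 andbT; apply/eqP => A0'.
  move: B0; rewrite le_eqVlt => /predU1P[B0'|B0].
    by have := H 1 ltr01; rewrite -A0' -B0' !mulr0 addr0; lra.
  have := H (B / S) (divr_gt0 B0 S0); rewrite -A0' mulr0 add0r invf_div.
  by rewrite divfK ?gt_eqF//; lra.
have {}B0 : 0 < B.
  rewrite lt_neqAle B0 andbT; apply/eqP => B0'.
  have := H (S / A) (divr_gt0 S0 A0); rewrite -B0' mulr0 addr0.
  by rewrite divfK ?gt_eqF//; lra.
have a0 : 0 < Num.sqrt A by rewrite sqrtr_gt0.
have b0 : 0 < Num.sqrt B by rewrite sqrtr_gt0.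
(* The weight t that balances t A and B / t. *)
have := H (Num.sqrt B / Num.sqrt A) (divr_gt0 b0 a0).
rewrite -{2}(sqr_sqrtr (ltW A0)) -{3}(sqr_sqrtr (ltW B0)) invf_div.
rewrite !expr2 mulrA divfK ?gt_eqF// [X in _ + X]mulrA divfK ?gt_eqF//.
by lra.
Qed.

Lemma amgm_weight (t a b : R) : 0 < t -> 2 * (a * b) <= t * a ^+ 2 + t^-1 * b ^+ 2.
Proof.
move=> t0; rewrite -subr_ge0.
have -> : t * a ^+ 2 + t^-1 * b ^+ 2 - 2 * (a * b) = t^-1 * (t * a - b) ^+ 2.
  by field; rewrite gt_eqF.
by rewrite mulr_ge0 ?sqr_ge0// invr_ge0 ltW.
Qed.

Lemma sum_cauchy_schwarz (T : finType) (a b : T -> R) :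
  \sum_i a i * b i <= Num.sqrt (\sum_i a i ^+ 2) * Num.sqrt (\sum_i b i ^+ 2).
Proof.
apply: weighted_amgm_optimum; try by apply: sumr_ge0 => i _; exact: sqr_ge0.
move=> t t0; rewrite !mulr_sumr -big_split/=; apply: ler_sum => i _.
exact: amgm_weight.
Qed.

Lemma rsummableM_sqr (I : choiceType) (a b : I -> R) :
  rsummable (fun i => a i ^+ 2) -> rsummable (fun i => b i ^+ 2) ->
  rsummable (fun i => a i * b i).
Proof.
move=> sa sb; apply: rsummable_le (rsummableD sa sb) _ => i.
have /= := amgm_weight `|a i| `|b i| ltr01.
rewrite -normrM invr1 !mul1r !real_normK ?num_real//.
have := normr_ge0 (a i * b i); lra.
Qed.

Lemma rsum_cauchy_schwarz (I : choiceType) (a b : I -> R) :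
  rsummable (fun i => a i ^+ 2) -> rsummable (fun i => b i ^+ 2) ->
  rsum setT (fun i => a i * b i) <=
  Num.sqrt (rsum setT (fun i => a i ^+ 2)) * Num.sqrt (rsum setT (fun i => b i ^+ 2)).
Proof.
move=> sa sb; have sab := rsummableM_sqr sa sb.
apply: weighted_amgm_optimum; try by apply: rsum_ge0 => i; exact: sqr_ge0.
move=> t t0; rewrite -!rsumZ// -rsumD; try exact: rsummableZ.
apply: le_rsum; [exact: rsummableZ|by apply: rsummableD; exact: rsummableZ|].
by move=> i; exact: amgm_weight.
Qed.

Section Young.
Variable I : zmodType.
Variables (a b c : I -> R).
Hypotheses (a0 : forall i, 0 <= a i) (b0 : forall i, 0 <= b i) (c0 : forall i, 0 <= c i).
Hypotheses (sa : rsummable a) (sb : rsummable (fun i => b i ^+ 2)) (sc : rsummable (fun i => c i ^+ 2)).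

Let shift_bij (h : I) : bijective (fun k : I => k - h).
Proof. by exists (fun k => k + h) => k; rewrite ?subrK ?addrK. Qed.

Let young_row h : rsummable (fun k => a h * b (k - h) * c k) /\
  rsum setT (fun k => a h * b (k - h) * c k) <=
  a h * (Num.sqrt (rsum setT (fun i => b i ^+ 2)) * Num.sqrt (rsum setT (fun i => c i ^+ 2))).
Proof.
have sb' : rsummable (fun k => b (k - h) ^+ 2).
  exact: (rsummable_reindex (shift_bij h) sb).
have -> : (fun k => a h * b (k - h) * c k) = (fun k => a h * (b (k - h) * c k)).
  by apply/funext => k; rewrite mulrA.
have sbc := rsummableM_sqr sb' sc.
split; first exact: rsummableZ.
rewrite rsumZ//; apply: ler_wpM2l => //.
rewrite (rsum_reindex (fun i => b i ^+ 2) (shift_bij h)).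
exact: rsum_cauchy_schwarz.
Qed.

Let swap_bij : bijective (fun z : I * I => (z.2, z.1)).
Proof. by exists (fun z : I * I => (z.2, z.1)) => -[]. Qed.

(** The inequality of Young for l1 * l2 -> l2, tested against an l2 sequence:
    for a fixed shift h, Cauchy-Schwarz and translation invariance bound the
    sum over k by the l2 norms, and a is then summed over h. *)
Lemma young_trilinear :
  rsummable (fun z : I * I => a z.2 * b (z.1 - z.2) * c z.1) /\
  rsum setT (fun z : I * I => a z.2 * b (z.1 - z.2) * c z.1) <=
  rsum setT a * Num.sqrt (rsum setT (fun i => b i ^+ 2)) * Num.sqrt (rsum setT (fun i => c i ^+ 2)).
Proof.
set K := Num.sqrt (rsum setT (fun i => b i ^+ 2)) * Num.sqrt (rsum setT (fun i => c i ^+ 2)).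
pose F (z : I * I) := a z.1 * b (z.2 - z.1) * c z.2.
have F0 z : 0 <= F z by rewrite /F !mulr_ge0.
have aK : rsummable (fun h => a h * K).
  by under eq_fun do rewrite mulrC; exact: rsummableZ.
have sF : rsummable F.
  apply: (rsummable_pair (g := fun h => a h * K)) => // h.
    by have [] := young_row h.
  have [_] := young_row h; apply: le_trans; rewrite le_eqVlt; apply/orP; left; apply/eqP.
  by apply: rsum_eq => k; rewrite ger0_norm.
split; first exact: (rsummable_reindex swap_bij sF).
rewrite -(rsum_reindex F swap_bij) -rsum_fubini// -mulrA -/K mulrC -rsumZ//.
under [X in _ <= rsum _ X]eq_fun do rewrite mulrC.
apply: le_rsum => //; first exact: rsummable_rsum.
by move=> h; have [] := young_row h.
Qed.

(** The substitution h -> k - h exchanges the roles of the two factors of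
    the convolution. *)
Lemma young_trilinear_swap :
  rsummable (fun z : I * I => a (z.1 - z.2) * b z.2 * c z.1) /\
  rsum setT (fun z : I * I => a (z.1 - z.2) * b z.2 * c z.1) <=
  rsum setT a * Num.sqrt (rsum setT (fun i => b i ^+ 2)) * Num.sqrt (rsum setT (fun i => c i ^+ 2)).
Proof.
have [sF le] := young_trilinear.
pose e (z : I * I) := (z.1, z.1 - z.2).
have be : bijective e.
  by exists e => -[k h]; rewrite /e /= opprB addrCA subrr addr0.
have E : (fun z : I * I => a (z.1 - z.2) * b z.2 * c z.1) =
    (fun z => a (e z).2 * b ((e z).1 - (e z).2) * c (e z).1).
  by apply/funext => -[k h]; rewrite /e /= opprB addrCA subrr addr0.
rewrite E; split; first exact: (rsummable_reindex be sF).
by apply: le_trans le; rewrite [leRHS](rsum_reindex _ be).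
Qed.

End Young.

(** The inequality of Young for products, applied to t and 1 with exponent p. *)
Lemma bernoulli_powR (t p : R) : 0 <= t -> 1 <= p -> 1 + p * (t - 1) <= t `^ p.
Proof.
move=> t0; rewrite le_eqVlt => /predU1P[<-|p1]; first by rewrite powRr1// mul1r; lra.
have p0 : 0 < p by lra.
have p1' : 0 < p - 1 by lra.
have q0 : 0 < p / (p - 1) by rewrite divr_gt0//; lra.
have pq : p^-1 + (p / (p - 1))^-1 = 1 by rewrite invf_div; field; rewrite gt_eqF.
have := conjugate_powR t0 ler01 p0 q0 pq.
rewrite powR1 mulr1 div1r invf_div -(ler_pM2l p0) mulrDr mulrCA mulfV ?gt_eqF// mulr1.
by rewrite [X in _ + X]mulrCA mulfV ?gt_eqF//; lra.
Qed.

(** Bernoulli for the ratio y / x; the same bound that the mean value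
    theorem gives for t -> t^p. *)
Lemma powR_sub_le (x y p : R) : 0 <= y -> y <= x -> 1 <= p ->
  x `^ p - y `^ p <= p * (x - y) * x `^ (p - 1).
Proof.
move=> y0 yx p1; have p0 : 0 < p by lra.
have [x0|x0] := leP x 0.
  have -> : x = 0 by lra.
  have -> : y = 0 by lra.
  by rewrite subrr subr0 mulr0 mul0r.
have xp : x `^ p = x * x `^ (p - 1) by rewrite mulr_powRB1// ltW.
have := bernoulli_powR (divr_ge0 y0 (ltW x0)) p1.
have X0 : 0 < x `^ p by exact: powR_gt0.
rewrite -(ler_pM2r X0) -powRM ?divr_ge0 ?(ltW x0)// divfK ?gt_eqF//.
have -> : p * (x - y) * x `^ (p - 1) = - (p * (y / x - 1) * x `^ p).
  by rewrite xp; field; rewrite gt_eqF.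
rewrite mulrDl mul1r; lra.
Qed.

Lemma powR_le_mono (x y p : R) : 0 <= p -> 0 <= x -> x <= y -> x `^ p <= y `^ p.
Proof. by move=> p0 x0 xy; apply: ge0_ler_powR => //; rewrite nnegrE// (le_trans x0). Qed.

(** Symbol of the commutator of |D|^p with a multiplication: the derivative
    loses one power, at the cost of one factor z. The factor 2 ^ (p - 1) arises
    from max (x, y) <= z + y <= 2 max (z, y). *)
Lemma powR_commutator (x y z p : R) : 0 <= x -> 0 <= y -> 0 <= z -> 1 <= p ->
  `|x - y| <= z ->
  `|x `^ p - y `^ p| <= p * 2 `^ (p - 1) * z * (z `^ (p - 1) + y `^ (p - 1)).
Proof.
move=> x0 y0 z0 p1 xyz; have p10 : 0 <= p - 1 by lra.
have p0 : 0 <= p by lra.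
set m := Num.max x y.
have m0 : 0 <= m by rewrite le_max x0.
have step : `|x `^ p - y `^ p| <= p * z * m `^ (p - 1).
  have := xyz; rewrite ler_norml => /andP[h1 h2].
  have [xy|yx] := leP x y.
    have mono := powR_le_mono p0 x0 xy.
    rewrite ler0_norm ?subr_le0// opprB.
    have := powR_sub_le x0 xy p1; rewrite /m (max_idPr xy) => /le_trans; apply.
    rewrite ler_wpM2r ?powR_ge0// ler_wpM2l//; lra.
  have mono := powR_le_mono p0 y0 (ltW yx).
  rewrite ger0_norm ?subr_ge0//.
  have := powR_sub_le y0 (ltW yx) p1; rewrite /m (max_idPl (ltW yx)) => /le_trans; apply.
  by rewrite ler_wpM2r ?powR_ge0// ler_wpM2l.
apply: le_trans step _.
have -> : p * 2 `^ (p - 1) * z * (z `^ (p - 1) + y `^ (p - 1)) =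
    p * z * (2 `^ (p - 1) * (z `^ (p - 1) + y `^ (p - 1))) by ring.
rewrite ler_wpM2l ?mulr_ge0//.
set u := Num.max z y.
have u0 : 0 <= u by rewrite le_max z0.
have mu : m <= 2 * u.
  have := xyz; rewrite ler_norml => /andP[h1 h2].
  have : z <= u by rewrite le_max lexx.
  have : y <= u by rewrite le_max lexx orbT.
  by rewrite ge_max => *; apply/andP; split; lra.
apply: le_trans (powR_le_mono p10 m0 mu) _.
rewrite powRM ?ler0n// ler_wpM2l ?powR_ge0//.
rewrite /u; case: (leP z y) => _.
  by rewrite lerDr powR_ge0.
by rewrite lerDl powR_ge0.
Qed.

End Inequalities.

(** * Euclidean norms of frequencies and amplitudes *)

Section Vectors.
Set Implicit Arguments.
Unset Strict Implicit.
Unset Printing Implicit Defensive.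
Variables (R : realType) (d : nat).
Local Open Scope complex_scope.
Local Notation C := R[i].
Local Notation Re := (@complex.Re R).
Implicit Types a b : 'rV[C]_d.

Lemma vnormE a : vnorm a = Num.sqrt (\sum_r normc (a 0 r) ^+ 2).
Proof.
rewrite /vnorm /dot (big_morph Re (id1 := 0) (op1 := +%R)) => [|[x y] [x' y']|//] //.
congr Num.sqrt; apply: eq_bigr => r _; rewrite mxE.
case: (a 0 r) => x y /=; rewrite sqr_sqrtr ?addr_ge0 ?sqr_ge0//.
by rewrite mulNr opprK -!expr2.
Qed.

Lemma vnorm_ge0 a : 0 <= vnorm a.
Proof. exact: sqrtr_ge0. Qed.

Lemma normc_sum_le (T : finType) (f : T -> C) : normc (\sum_i f i) <= \sum_i normc (f i).
Proof.
elim/big_ind2 : _ => [|x1 x2 y1 y2 h1 h2|//]; first by rewrite normc0.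
by apply: le_trans (le_normcD _ _) _; exact: lerD.
Qed.

Lemma normc_dot_le a b : normc (dot a b) <= vnorm a * vnorm b.
Proof.
apply: le_trans (normc_sum_le _) _; rewrite !vnormE.
under eq_bigr do rewrite normcM.
exact: sum_cauchy_schwarz.
Qed.

Lemma vnorm_conjv a : vnorm (conjv a) = vnorm a.
Proof. by rewrite !vnormE; under eq_bigr do rewrite mxE normcJ'. Qed.

Lemma vnormN a : vnorm (- a) = vnorm a.
Proof. by rewrite !vnormE; under eq_bigr do rewrite mxE normcN. Qed.

Lemma vnorm0 : vnorm (0 : 'rV[C]_d) = 0.
Proof.
by rewrite vnormE big1 ?sqrtr0// => r _; rewrite mxE normc0 expr0n.
Qed.

Lemma vnorm_coord a r : normc (a 0 r) <= vnorm a.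
Proof.
rewrite vnormE -[leLHS]ger0_norm ?normc_ge0// -sqrtr_sqr ler_wsqrtr//.
by rewrite (bigD1 r)//= lerDl sumr_ge0// => i _; exact: sqr_ge0.
Qed.

Lemma vnormD a b : vnorm (a + b) <= vnorm a + vnorm b.
Proof.
have A0 : 0 <= \sum_r normc (a 0 r) ^+ 2 by apply: sumr_ge0 => r _; exact: sqr_ge0.
have B0 : 0 <= \sum_r normc (b 0 r) ^+ 2 by apply: sumr_ge0 => r _; exact: sqr_ge0.
rewrite !vnormE -[leRHS]ger0_norm ?addr_ge0 ?sqrtr_ge0// -sqrtr_sqr ler_wsqrtr//.
rewrite sqrrD !sqr_sqrtr//.
have CS := sum_cauchy_schwarz (fun r => normc (a 0 r)) (fun r => normc (b 0 r)).
apply: (@le_trans _ _ (\sum_r (normc (a 0 r) + normc (b 0 r)) ^+ 2)).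
  apply: ler_sum => r _; rewrite mxE lerXn2r ?nnegrE ?addr_ge0 ?normc_ge0//.
  exact: le_normcD.
under eq_bigr do rewrite sqrrD -mulr_natr.
rewrite !big_split/= lerD2r lerD2l -mulr_suml -[leRHS]mulr_natr ler_wpM2r//.
Qed.

Lemma dot_conjv_self a : dot (conjv a) a = (vnorm a ^+ 2)%:C.
Proof.
rewrite vnormE sqr_sqrtr; last by apply: sumr_ge0 => r _; exact: sqr_ge0.
rewrite rmorph_sum /dot; apply: eq_bigr => r _; rewrite mxE.
by rewrite mulrC -sqr_normc normc_def -rmorphXn /=; case: (a 0 r).
Qed.

Implicit Types h k l : 'rV[int]_d.

Lemma zvecD k l : zvec R (k + l) = zvec R k + zvec R l.
Proof. by apply/rowP => r; rewrite !mxE rmorphD. Qed.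

Lemma zvecN k : zvec R (- k) = - zvec R k.
Proof. by apply/rowP => r; rewrite !mxE rmorphN. Qed.

Lemma znorm_ge0 k : 0 <= znorm R k.
Proof. exact: vnorm_ge0. Qed.

Lemma znormN k : znorm R (- k) = znorm R k.
Proof. by rewrite /znorm zvecN vnormN. Qed.

Lemma znorm_sub_le k h : `|znorm R k - znorm R (k - h)| <= znorm R h.
Proof.
rewrite ler_norml; apply/andP; split.
  rewrite lerNl opprB lerBlDl -[znorm R h]znormN /znorm.
  by apply: le_trans (vnormD _ _); rewrite zvecD.
rewrite lerBlDl /znorm; apply: le_trans (vnormD _ _).
by rewrite -zvecD subrK.
Qed.

Lemma znorm_coord k r : (absz (k 0 r))%:R <= znorm R k.
Proof.
apply: le_trans (vnorm_coord _ r); rewrite mxE.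
rewrite -[X in normc X](rmorph_int (real_complex R)) normcR.
by rewrite natr_absz -intr_norm.
Qed.

Lemma znorm_ge1 k : k != 0 -> 1 <= znorm R k.
Proof.
move=> /eqP k0; have [r kr] : exists r, k 0 r != 0.
  apply/existsP; rewrite -negb_forall; apply/negP => /forallP H; apply: k0; apply/rowP => r.
  by rewrite mxE; apply/eqP; exact: H.
apply: le_trans (znorm_coord k r).
by rewrite ler1n absz_gt0.
Qed.

End Vectors.

(** * Convergence of the lattice zeta series *)

Section Zeta.
Set Implicit Arguments.
Unset Strict Implicit.
Unset Printing Implicit Defensive.
Variables (R : realType).

Lemma rsummable_nat (u : nat -> R) (B : R) : (forall n, 0 <= u n) ->
  (forall N, \sum_(0 <= n < N) u n <= B) -> rsummable u.
Proof.
move=> u0 uB; rewrite /rsummable /summable -nneseries_esumT//.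
apply: (@le_lt_trans _ _ B%:E); last exact: ltry.
apply: lime_le; first exact: is_cvg_nneseries.
apply: nearW => n /=.
under eq_bigr do rewrite ger0_norm//.
by rewrite sumEFin lee_fin.
Qed.

(** Integral comparison in discrete form: b (x + 1)^(- b - 1) is at most the
    increment of - x^(- b), since ln t <= t - 1 and 1 + u <= exp u. *)
Lemma powR_telescope (x b : R) : 0 < x -> 0 < b ->
  b * ((x + 1) `^ (b + 1))^-1 <= (x `^ b)^-1 - ((x + 1) `^ b)^-1.
Proof.
move=> x0 b0; have y0 : 0 < x + 1 by rewrite addr_gt0.
have Y0 : 0 < (x + 1) `^ b by exact: powR_gt0.
have X0 : 0 < x `^ b by exact: powR_gt0.
have t0 : 0 < x / (x + 1) by rewrite divr_gt0.
rewrite powRD ?(gt_eqF y0) ?implybT// powRr1 ?(ltW y0)//.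
rewrite -(ler_pM2r Y0) mulrBl mulVf ?gt_eqF//.
have -> : b * ((x + 1) `^ b * (x + 1))^-1 * (x + 1) `^ b = b / (x + 1).
  by field; rewrite !gt_eqF.
have -> : (x `^ b)^-1 * (x + 1) `^ b = expR (- (b * ln (x / (x + 1)))).
  rewrite ln_div ?posrE// expRN mulrBr expRB invf_div mulrC.
  by rewrite /powR !gt_eqF.
have h1 := expR_ge1Dx (- (b * ln (x / (x + 1)))).
have h2 : ln (x / (x + 1)) <= - (x + 1)^-1.
  have -> : x / (x + 1) = 1 + - (x + 1)^-1 by field; rewrite gt_eqF.
  apply: le_ln1Dx; rewrite ltrN2 invf_lt1//; lra.
have h3 : b * ln (x / (x + 1)) <= - (b / (x + 1)).
  by rewrite -mulrN ler_wpM2l// ltW.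
lra.
Qed.

Lemma rsummable_riemann (s : R) : 1 < s ->
  rsummable (fun n : nat => (n.+1%:R `^ s)^-1).
Proof.
move=> s1; have b0 : 0 < s - 1 by lra.
apply: (@rsummable_nat _ (1 + (s - 1)^-1)) => [n|N].
  by rewrite invr_ge0 powR_ge0.
suff H : \sum_(0 <= n < N.+1) (n.+1%:R `^ s)^-1 <=
    1 + (s - 1)^-1 * (1 - (N.+1%:R `^ (s - 1))^-1).
  apply: (@le_trans _ _ (\sum_(0 <= n < N.+1) (n.+1%:R `^ s)^-1)).
    by rewrite big_nat_recr//= lerDl invr_ge0 powR_ge0.
  apply: le_trans H _; rewrite lerD2l mulrBr mulr1 gerBl.
  by rewrite mulr_ge0 ?invr_ge0 ?powR_ge0// ltW.
elim: N => [|N ih].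
  by rewrite big_nat1 powR1 invr1 subrr mulr0 addr0.
rewrite big_nat_recr//=; apply: le_trans (lerD ih (lexx _)) _.
have := powR_telescope (x := N.+1%:R) ltac:(by rewrite ltr0n) b0.
rewrite subrK natr1 -(ler_pM2l (x := (s - 1)^-1)) ?invr_gt0//.
rewrite mulrA mulVf ?gt_eqF// mul1r; lra.
Qed.

Lemma rsummable_fin (T : finType) (f : T -> R) : rsummable f.
Proof.
have [+ _] := rsum_fset_mask f (enum_uniq T).
by congr rsummable; apply/funext => t; rewrite mem_enum.
Qed.

Lemma rsummable_int (s : R) : 1 < s ->
  rsummable (fun m : int => ((1 + (absz m)%:R) `^ s)^-1).
Proof.
move=> s1; have s0 : 0 <= s by lra.
pose e (z : bool * nat) : int := if z.1 then Posz z.2 else Negz z.2.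
pose e' (m : int) : bool * nat := match m with Posz n => (true, n) | Negz n => (false, n) end.
have be' : bijective e'.
  by exists e => [[n|n]|[[] n]].
pose f (z : bool * nat) : R := ((1 + (absz (e z))%:R) `^ s)^-1.
have -> : (fun m : int => ((1 + (absz m)%:R) `^ s)^-1) = (fun m => f (e' m)).
  by apply/funext => -[].
apply: rsummable_reindex => //.
have fs b : rsummable (fun n => f (b, n)).
  apply: rsummable_le (rsummable_riemann s1) _ => n.
  rewrite ger0_norm ?invr_ge0 ?powR_ge0// /f lef_pV2 ?posrE ?powR_gt0 ?ltr0n ?ltr_wpDr//.
  apply: powR_le_mono => //.
  by rewrite -natr1 addrC lerD2l ler_nat /e; case: b.
apply: (rsummable_pair (g := fun b => rsum setT (fun n => `|f (b, n)|))) => //.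
exact: rsummable_fin.
Qed.

(** Induction on d, splitting off the first coordinate. *)
Lemma rsummable_prod (d : nat) (u : int -> R) : (forall m, 0 <= u m) -> rsummable u ->
  rsummable (fun k : 'rV[int]_d => \prod_r u (k 0 r)).
Proof.
move=> u0 us; elim: d => [|d ih].
  have [+ _] := rsum_fset_mask (fun k : 'rV[int]_0 => \prod_r u (k 0 r)) (A := [:: 0]) isT.
  by congr rsummable; apply/funext => k; rewrite mem_seq1 [k]thinmx0 eqxx.
pose e (k : 'rV[int]_(1 + d)) : int * 'rV[int]_d := (lsubmx k 0 0, rsubmx k).
have be : bijective e.
  exists (fun z => row_mx z.1%:M z.2) => [k|[m x]] /=.
    by rewrite -[RHS]hsubmxK /e /= [lsubmx k in RHS]mx11_scalar.
  by rewrite /e row_mxKl row_mxKr mxE eqxx mulr1n.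
pose f (z : int * 'rV[int]_d) := u z.1 * \prod_r u (z.2 0 r).
have -> : (fun k : 'rV[int]_d.+1 => \prod_r u (k 0 r)) = (fun k => f (e k)).
  apply/funext => k; rewrite big_ord_recl /f /e /= mxE; congr (u (k _ _) * _).
    exact: val_inj.
  by apply: eq_bigr => r _; rewrite mxE; congr (u (k _ _)); apply: val_inj.
apply: rsummable_reindex => //.
have p0 (x : 'rV[int]_d) : 0 <= \prod_r u (x 0 r) by apply: prodr_ge0.
apply: (rsummable_pair (g := fun m => rsum setT (fun x : 'rV[int]_d => \prod_r u (x 0 r)) * u m)).
- by move=> m; exact: (rsummableZ (u m) ih).
- exact: (rsummableZ _ us).
- move=> m; rewrite mulrC -rsumZ//; apply: le_rsum.
  + by apply: rsummable_abs; exact: (rsummableZ (u m) ih).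
  + exact: (rsummableZ (u m) ih).
  + by move=> x; rewrite ger0_norm// mulr_ge0.
Qed.

(** A nonzero lattice vector h satisfies 1 + |h_r| <= 2 |h| for every r, so
    |h|^(- s) is at most 2^s times the product over r of (1 + |h_r|)^(- s / d).
    This decouples the coordinates, and s / d > 1. *)
Lemma rsummable_zeta (d : nat) (s : R) : (0 < d)%N -> d%:R < s ->
  rsummable (fun h : 'rV[int]_d => if h == 0 then 0 else (znorm R h `^ s)^-1).
Proof.
move=> d0 ds; have dR : 0 < d%:R :> R by rewrite ltr0n.
have s0 : 0 < s by lra.
have sd : 1 < s / d%:R by rewrite ltr_pdivlMr// mul1r.
pose u (m : int) : R := ((1 + (absz m)%:R) `^ (s / d%:R))^-1.
have u0 m : 0 <= u m by rewrite invr_ge0 powR_ge0.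
have us := rsummable_prod d u0 (rsummable_int sd).
apply: rsummable_le (rsummableZ (2 `^ s) us) _ => h.
have [_|h0] := eqVneq h 0.
  by rewrite normr0 mulr_ge0 ?powR_ge0// prodr_ge0.
have z1 : 1 <= znorm R h := znorm_ge1 R h0.
have z0 : 0 < znorm R h by lra.
rewrite ger0_norm ?invr_ge0 ?powR_ge0//.
rewrite prodfV ler_pdivlMr; last by apply: prodr_gt0 => r _; rewrite powR_gt0// ltr_wpDr.
rewrite ler_pdivrMl ?powR_gt0// mulrC -powRM ?ler0n ?(ltW z0)// mulrC.
apply: (@le_trans _ _ (\prod_(r < d) (2 * znorm R h) `^ (s / d%:R))).
  apply: ler_prod => r _; rewrite powR_ge0/=; apply: powR_le_mono.
  - by rewrite ltW// (lt_trans ltr01).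
  - by rewrite addr_ge0.
  - have := znorm_coord R h r; lra.
rewrite prodr_const card_ord -powR_mulrn ?powR_ge0// -powRrM divfK ?gt_eqF//.
by rewrite [_ * 2]mulrC.
Qed.

End Zeta.

(** * The iterated integral over the torus *)

Section TorusReal.
Set Implicit Arguments.
Unset Strict Implicit.
Unset Printing Implicit Defensive.
Variables (R : realType).
Local Notation mu := (@lebesgue_measure R).
Local Notation tau := (2 * @pi R).

Let tau0 : 0 < tau.
Proof. by rewrite mulr_gt0// pi_gt0. Qed.

(** Uniform continuity on the whole space is stable under restriction to
    slices and under uniform limits, and it makes every partial integral in the
    iterated integral continuous in the remaining variable, hence integrable. *)
Definition ucont d (f : 'rV[R]_d -> R) := forall e : R, 0 < e ->
  exists2 de : R, 0 < de & forall x y : 'rV[R]_d,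
    (forall r, `|x 0 r - y 0 r| <= de) -> `|f x - f y| <= e.

Lemma ucont_cst d (c : R) : ucont (fun _ : 'rV[R]_d => c).
Proof. by move=> e e0; exists 1 => // x y _; rewrite subrr normr0 ltW. Qed.

Lemma ucontD d (f g : 'rV[R]_d -> R) : ucont f -> ucont g -> ucont (fun x => f x + g x).
Proof.
move=> uf ug e e0; have e20 : 0 < e / 2 by rewrite divr_gt0.
have [d1 d10 H1] := uf _ e20; have [d2 d20 H2] := ug _ e20.
exists (Num.min d1 d2) => [|x y xy]; first by rewrite lt_min d10.
rewrite opprD addrACA (splitr e); apply: le_trans (ler_normD _ _) _.
by rewrite lerD ?H1 ?H2// => r; have := xy r; rewrite le_min => /andP[].
Qed.

Lemma ucontM d (f g : 'rV[R]_d -> R) (A B : R) : ucont f -> ucont g ->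
  (forall x, `|f x| <= A) -> (forall x, `|g x| <= B) -> ucont (fun x => f x * g x).
Proof.
move=> uf ug fA gB e e0.
have A0 : 0 <= A by apply: le_trans (fA 0).
have B0 : 0 <= B by apply: le_trans (gB 0).
have A1 : 0 < A + 1 by lra.
have B1 : 0 < B + 1 by lra.
have [d1 d10 H1] := uf _ (divr_gt0 (divr_gt0 e0 (ltr0n _ 2)) B1).
have [d2 d20 H2] := ug _ (divr_gt0 (divr_gt0 e0 (ltr0n _ 2)) A1).
exists (Num.min d1 d2) => [|x y xy]; first by rewrite lt_min d10.
have h1 : `|f x - f y| <= e / 2 / (B + 1) by apply: H1 => r; have := xy r; rewrite le_min => /andP[].
have h2 : `|g x - g y| <= e / 2 / (A + 1) by apply: H2 => r; have := xy r; rewrite le_min => /andP[].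
have -> : f x * g x - f y * g y = (f x - f y) * g x + f y * (g x - g y) by ring.
apply: le_trans (ler_normD _ _) _; rewrite !normrM (splitr e) lerD//.
  apply: (@le_trans _ _ (e / 2 / (B + 1) * (B + 1))); last by rewrite divfK ?gt_eqF.
  by rewrite ler_pM//; have := gB x; lra.
apply: (@le_trans _ _ ((A + 1) * (e / 2 / (A + 1)))); last by rewrite mulrC divfK ?gt_eqF.
by rewrite ler_pM//; have := fA y; lra.
Qed.

Lemma ucontZ d (f : 'rV[R]_d -> R) (c : R) : ucont f -> ucont (fun x => c * f x).
Proof.
move=> uf e e0; have c1 : 0 < `|c| + 1 by rewrite ltr_wpDl.
have [d1 d10 H1] := uf _ (divr_gt0 e0 c1).
exists d1 => // x y xy; rewrite -mulrBr normrM.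
apply: (@le_trans _ _ ((`|c| + 1) * (e / (`|c| + 1)))); last by rewrite mulrC divfK ?gt_eqF.
by rewrite ler_pM ?H1// lerDl.
Qed.

Lemma ucontB d (f g : 'rV[R]_d -> R) : ucont f -> ucont g -> ucont (fun x => f x - g x).
Proof.
move=> uf ug; have := ucontD uf (ucontZ (-1) ug).
by under eq_fun do rewrite mulN1r.
Qed.

Lemma ucont_sum d (I : Type) (s : seq I) (f : I -> 'rV[R]_d -> R) :
  (forall i, ucont (f i)) -> ucont (fun x => \sum_(i <- s) f i x).
Proof.
move=> uf; elim: s => [|i s ih].
  by under eq_fun do rewrite big_nil; exact: ucont_cst.
by under eq_fun do rewrite big_cons; exact: ucontD.
Qed.

Definition slice d (f : 'rV[R]_d.+1 -> R) (t : R) : 'rV[R]_d -> R :=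
  fun x => f (row_mx (t%:M : 'rV[R]_1) x).

Lemma row_mx_dist d (t s : R) (x y : 'rV[R]_d) (de : R) : `|t - s| <= de ->
  (forall r, `|x 0 r - y 0 r| <= de) ->
  forall r : 'I_(1 + d), `|row_mx (t%:M : 'rV[R]_1) x 0 r - row_mx (s%:M : 'rV[R]_1) y 0 r| <= de.
Proof.
move=> ts xy r; case: (split_ordP r) => j ->; last by rewrite !row_mxEr.
by rewrite !row_mxEl !mxE !ord1 eqxx !mulr1n.
Qed.

Lemma ucont_slice d (f : 'rV[R]_d.+1 -> R) t : ucont f -> ucont (slice f t).
Proof.
move=> uf e e0; have [de d0 H] := uf _ e0.
exists de => // x y xy; apply: H; apply: row_mx_dist => //.
by rewrite subrr normr0 ltW.
Qed.

Definition torus_linear d := forall (f g : 'rV[R]_d -> R) c, ucont f -> ucont g ->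
  torus_rint (fun x => c * f x + g x) = c * torus_rint f + torus_rint g.

Definition torus_bounded d := forall (f : 'rV[R]_d -> R) M, ucont f ->
  (forall x, `|f x| <= M) -> `|torus_rint f| <= tau ^+ d * M.

Let integrable_itv (F : R -> R) : continuous F ->
  mu.-integrable `[0, tau] (EFin \o F).
Proof.
move=> cF; apply: continuous_compact_integrable; first exact: segment_compact.
exact: continuous_subspaceT.
Qed.

Let fine_mu_itv : fine (mu `[0, tau]%classic) = tau.
Proof. by rewrite lebesgue_measure_itv/= lte_fin tau0 sube0. Qed.

Let slice_continuous d : torus_linear d -> torus_bounded d ->
  forall f : 'rV[R]_d.+1 -> R, ucont f -> continuous (fun t => torus_rint (slice f t)).
Proof.
move=> lin bnd f uf t; apply/cvgrPdist_le => e e0.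
have K0 : 0 < tau ^+ d by rewrite exprn_gt0.
have [de d0 H] := uf _ (divr_gt0 e0 K0).
near=> s.
have -> : torus_rint (slice f t) - torus_rint (slice f s) =
    torus_rint (fun x => -1 * slice f s x + slice f t x).
  by rewrite lin; [rewrite mulN1r addrC|exact: ucont_slice..].
apply: (@le_trans _ _ (tau ^+ d * (e / tau ^+ d))); last by rewrite mulrC divfK ?gt_eqF.
apply: bnd; first by apply: ucontD; [apply: ucontZ|]; exact: ucont_slice.
move=> x; rewrite mulN1r addrC; apply: H; apply: row_mx_dist; last first.
  by move=> r; rewrite subrr normr0 ltW.
by near: s; exact: cvgr_dist_le.
Unshelve. all: by end_near. Qed.

(** Linearity and boundedness are proved together: in the inductive step both
    are needed for the integrability of the inner integral. *)
Lemma torus_rint_props d : torus_linear d /\ torus_bounded d.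
Proof.
elim: d => [|d [lin bnd]].
  by split => [f g c _ _ //|f M _ fM /=]; rewrite expr0 mul1r.
have cont := slice_continuous lin bnd.
split => [f g c uf ug|f M uf fM].
  rewrite [LHS]/= -[torus_rint f]/(\int[mu]_(t in `[0, tau]) torus_rint (slice f t)).
  rewrite -[torus_rint g]/(\int[mu]_(t in `[0, tau]) torus_rint (slice g t)).
  have cf := integrable_itv (cont _ uf); have cg := integrable_itv (cont _ ug).
  rewrite -RintegralZl// -RintegralD//.
    apply: eq_Rintegral => t _; rewrite -lin//; exact: ucont_slice.
  apply: integrable_itv => t; apply: cvgM; [exact: cvg_cst|exact: cont].
rewrite -[torus_rint f]/(\int[mu]_(t in `[0, tau]) torus_rint (slice f t)).
have cf := integrable_itv (cont _ uf).
apply: le_trans (le_normr_Rintegral _ cf) _ => //.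
apply: (@le_trans _ _ (\int[mu]_(t in `[0, tau]) (tau ^+ d * M))).
  apply: le_Rintegral => //.
  - apply: integrable_itv => t; apply: cvg_norm; exact: cont.
  - apply: integrable_itv => t; exact: cvg_cst.
  - by move=> t _; apply: bnd; [exact: ucont_slice|move=> x; exact: fM].
by rewrite Rintegral_cst// fine_mu_itv exprSr mulrAC.
Qed.

Lemma torus_rint_lin d (f g : 'rV[R]_d -> R) c : ucont f -> ucont g ->
  torus_rint (fun x => c * f x + g x) = c * torus_rint f + torus_rint g.
Proof. by move=> uf ug; have [lin _] := torus_rint_props d; exact: lin. Qed.

Lemma torus_rint_bound d (f : 'rV[R]_d -> R) M : ucont f ->
  (forall x, `|f x| <= M) -> `|torus_rint f| <= tau ^+ d * M.
Proof. by have [_ bnd] := torus_rint_props d; exact: bnd. Qed.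

Lemma torus_rint_eq d (f g : 'rV[R]_d -> R) : f =1 g -> torus_rint f = torus_rint g.
Proof. by move=> /funext ->. Qed.

Lemma torus_rint0 d : torus_rint (fun _ : 'rV[R]_d => 0) = 0.
Proof.
apply/eqP; rewrite -normr_eq0 eq_le normr_ge0 andbT -[leRHS](mulr0 (tau ^+ d)).
by apply: torus_rint_bound; [exact: ucont_cst|move=> x; rewrite normr0].
Qed.

Lemma torus_rintD d (f g : 'rV[R]_d -> R) : ucont f -> ucont g ->
  torus_rint (fun x => f x + g x) = torus_rint f + torus_rint g.
Proof.
move=> uf ug; rewrite -[torus_rint f]mul1r -torus_rint_lin//.
by apply: torus_rint_eq => x; rewrite mul1r.
Qed.

Lemma torus_rintZ d (f : 'rV[R]_d -> R) c : ucont f ->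
  torus_rint (fun x => c * f x) = c * torus_rint f.
Proof.
move=> uf; rewrite -[RHS]addr0 -(torus_rint0 d) -torus_rint_lin//; last exact: ucont_cst.
by apply: torus_rint_eq => x; rewrite addr0.
Qed.

Lemma torus_rintB d (f g : 'rV[R]_d -> R) : ucont f -> ucont g ->
  torus_rint (fun x => f x - g x) = torus_rint f - torus_rint g.
Proof.
move=> uf ug; rewrite -mulN1r -torus_rintZ// -torus_rintD//; last exact: ucontZ.
by apply: torus_rint_eq => x; rewrite mulN1r.
Qed.

Lemma torus_rint_sum d (I : Type) (s : seq I) (f : I -> 'rV[R]_d -> R) :
  (forall i, ucont (f i)) ->
  torus_rint (fun x => \sum_(i <- s) f i x) = \sum_(i <- s) torus_rint (f i).
Proof.
move=> uf; elim: s => [|i s ih].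
  by rewrite big_nil -[RHS](torus_rint0 d); apply: torus_rint_eq => x; rewrite big_nil.
rewrite big_cons -ih -torus_rintD//; last exact: ucont_sum.
by apply: torus_rint_eq => x; rewrite big_cons.
Qed.

Lemma ucont_rsum d (I : choiceType) (f : I -> 'rV[R]_d -> R) (b : I -> R) :
  rsummable b -> (forall i, ucont (f i)) -> (forall i x, `|f i x| <= b i) ->
  ucont (fun x => rsum setT (fun i => f i x)).
Proof.
move=> bs uf fb e e0; have e30 : 0 < e / 3 by rewrite divr_gt0.
have [A uA HA] := rsum_approx bs e30.
have [de d0 H] := ucont_sum A uf e30.
exists de => // x y /H; have := HA _ (fb^~ x); have := HA _ (fb^~ y).
rewrite !ler_norml => /andP[? ?] /andP[? ?] /andP[? ?]; apply/andP; split; lra.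
Qed.

(** Termwise integration: the partial sums converge uniformly, and the torus
    has finite measure. *)
Lemma torus_rint_rsum d (I : choiceType) (f : I -> 'rV[R]_d -> R) (b : I -> R) :
  rsummable b -> (forall i, ucont (f i)) -> (forall i x, `|f i x| <= b i) ->
  torus_rint (fun x => rsum setT (fun i => f i x)) = rsum setT (fun i => torus_rint (f i)).
Proof.
move=> bs uf fb; have urs := ucont_rsum bs uf fb.
have K0 : 0 < tau ^+ d by rewrite exprn_gt0.
apply/eqP; rewrite -subr_eq0 -normr_le0; apply/ler_addgt0Pr => e e0; rewrite add0r.
have e20 : 0 < e / 2 / tau ^+ d by rewrite !divr_gt0.
have [A uA HA] := rsum_approx bs e20.
have h1 : `|torus_rint (fun x => rsum setT (fun i => f i x)) - \sum_(i <- A) torus_rint (f i)| <= e / 2.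
  rewrite -torus_rint_sum// -torus_rintB//; last exact: ucont_sum.
  apply: le_trans (@torus_rint_bound _ _ (e / 2 / tau ^+ d) _ _) _.
  - by apply: ucontB => //; exact: ucont_sum.
  - by move=> x; apply: HA.
  - by rewrite mulrC divfK ?gt_eqF.
have Tb i : `|(tau ^+ d)^-1 * torus_rint (f i)| <= b i.
  rewrite normrM ger0_norm ?invr_ge0 ?(ltW K0)// ler_pdivrMl//.
  exact: torus_rint_bound.
have Ts : rsummable (fun i => torus_rint (f i)).
  apply: rsummable_le (rsummableZ (tau ^+ d) bs) _ => i.
  exact: torus_rint_bound.
have := HA _ Tb; rewrite rsumZ// -mulr_sumr -mulrBr normrM ger0_norm ?invr_ge0 ?(ltW K0)//.
rewrite ler_pdivrMl// mulrC divfK ?gt_eqF// => h2.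
move: h1 h2; rewrite !ler_norml => /andP[? ?] /andP[? ?]; apply/andP; split; lra.
Qed.

Definition rvec d (k : 'rV[int]_d) : 'rV[R]_d := map_mx (fun z : int => z%:~R) k.

(** Uniform continuity of cos from the addition formulas and continuity at 0. *)
Lemma cosB_small (e : R) : 0 < e -> exists2 de : R, 0 < de &
  forall a b : R, `|a - b| <= de -> `|cos a - cos b| <= e.
Proof.
move=> e0; have e20 : 0 < e / 2 by rewrite divr_gt0.
have /cvgrPdist_le/(_ _ e20)/nbhs_ballP[d1 /= d10 H1] := @continuous_cos R 0.
have /cvgrPdist_le/(_ _ e20)/nbhs_ballP[d2 /= d20 H2] := @continuous_sin R 0.
exists (Num.min d1 d2 / 2) => [|a b ab]; first by rewrite divr_gt0// lt_min d10.
have m0 : 0 < Num.min d1 d2 by rewrite lt_min d10.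
have ltm : `|a - b| < Num.min d1 d2.
  by apply: le_lt_trans ab _; rewrite ltr_pdivrMr// ltr_pMr// ltr1n.
have [h1 h2] : `|a - b| < d1 /\ `|a - b| < d2 by move: ltm; rewrite lt_min => /andP[].
have c1 : `|cos 0 - cos (a - b)| <= e / 2.
  by apply: H1; rewrite /ball /= sub0r normrN.
have c2 : `|sin 0 - sin (a - b)| <= e / 2.
  by apply: H2; rewrite /ball /= sub0r normrN.
rewrite cos0 in c1; rewrite sin0 sub0r normrN in c2.
have -> : cos a - cos b = - (cos b * (1 - cos (a - b)) + sin b * sin (a - b)).
  have -> : cos a = cos (b + (a - b)) by congr cos; ring.
  by rewrite cosD; ring.
rewrite normrN; apply: le_trans (ler_normD _ _) _; rewrite !normrM (splitr e).
apply: lerD; [apply: le_trans c1|apply: le_trans c2]; apply: ler_piMl => //.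
  exact: cos_max.
exact: sin_max.
Qed.

Lemma ucont_cos d (k : 'rV[int]_d) (c : R) : ucont (fun x => cos (dot (rvec k) x + c)).
Proof.
move=> e e0; have [de d0 H] := cosB_small e0.
pose K := 1 + \sum_r `|rvec k 0 r|.
have K0 : 0 < K by rewrite ltr_wpDr// sumr_ge0.
exists (de / K); first by rewrite divr_gt0.
move=> x y xy; apply: H.
rewrite opprD addrACA subrr addr0 /dot -sumrB.
apply: le_trans (ler_norm_sum _ _ _) _.
apply: (@le_trans _ _ (\sum_r `|rvec k 0 r| * (de / K))).
  by apply: ler_sum => r _; rewrite -mulrBr normrM ler_wpM2l.
rewrite -mulr_suml mulrC -mulrA ler_piMr ?(ltW d0)//.
by rewrite mulrC ler_pdivrMr// mul1r /K lerDr.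
Qed.

Lemma integral_cos (m : int) (c : R) :
  \int[mu]_(t in `[0, tau]) cos (m%:~R * t + c) = if m == 0 then tau * cos c else 0.
Proof.
have [->|m0] := eqVneq m 0.
  under eq_Rintegral do rewrite mul0r add0r.
  by rewrite Rintegral_cst// fine_mu_itv mulrC.
have mR : (m%:~R : R) != 0 by rewrite intr_eq0.
have dF (x : R) : is_derive x 1 (fun t : R => m%:~R^-1 * sin (m%:~R * t + c) : R)
    (cos (m%:~R * x + c)).
  apply: is_derive_eq.
  rewrite /GRing.scale/= !(mulr0, mul0r, addr0, add0r, mulr1).
  by field.
rewrite /Rintegral (@continuous_FTC2 _ _ (fun t => m%:~R^-1 * sin (m%:~R * t + c)))//=.
- have -> : sin (m%:~R * tau + c) = sin c.
    rewrite addrC.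
    have per (n : nat) (x : R) : sin (x + n%:R * tau) = sin x.
      elim: n => [|n ih]; first by rewrite mul0r addr0.
      rewrite -natr1 mulrDl mul1r addrA.
      by rewrite [X in sin (_ + X) = _](mulr_natl pi 2) sinD2pi.
    case: m {m0 mR dF} => n; first exact: per.
    by rewrite NegzE mulrNz mulNr -[LHS](per n.+1) subrK.
  by rewrite mulr0 add0r subrr.
- apply: continuous_subspaceT => t; apply: continuous_comp; last exact: continuous_cos.
  by apply: cvgD; [apply: cvgM; [exact: cvg_cst|exact: cvg_id]|exact: cvg_cst].
- have cont : continuous (fun t : R => m%:~R^-1 * sin (m%:~R * t + c)).
    by move=> t; apply: differentiable_continuous; apply/derivable1_diffP; apply: ex_derive.
  split; first by move=> t _; apply: ex_derive.
  + by apply: cvg_at_right_filter; exact: cont.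
  + by apply: cvg_at_left_filter; exact: cont.
- by move=> t _; rewrite derive1E; apply: derive_val.
Qed.

(** The phase c makes the induction on the dimension close within real
    integrands: after integrating out the other coordinates, the first one
    contributes to the phase. It also covers sin (phase - pi / 2). *)
Lemma torus_rint_cos d (k : 'rV[int]_d) (c : R) :
  torus_rint (fun x => cos (dot (rvec k) x + c)) = if k == 0 then tau ^+ d * cos c else 0.
Proof.
elim: d k c => [|d ih] k c.
  by rewrite /= [k]thinmx0 eqxx expr0 mul1r /dot big_ord0 add0r.
pose k' : 'rV[int]_d := rsubmx (k : 'rV[int]_(1 + d)).
have kE : (k == 0) = (k 0 0 == 0) && (k' == 0).
  apply/eqP/andP => [k0|[/eqP k0 /eqP k'0]].
    by rewrite /k' k0; split; apply/eqP; [rewrite mxE|apply/rowP => r; rewrite !mxE].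
  apply/rowP => r; rewrite mxE; case: (unliftP 0 r) => [j|] ->; last exact: k0.
  have := congr1 (fun M : 'rV[int]_d => M 0 j) k'0; rewrite !mxE => <-.
  by congr (k _ _); apply: val_inj.
have dotE t x : dot (rvec k) (row_mx (t%:M : 'rV[R]_1) x : 'rV[R]_d.+1) =
    (k 0 0)%:~R * t + dot (rvec k') x.
  rewrite /dot big_ord_recl; congr (_ + _).
    rewrite mxE; congr (_ * _).
    rewrite (_ : ord0 = lshift d (0 : 'I_1)); last exact: val_inj.
    by rewrite [LHS](@row_mxEl R 1 1 d) mxE eqxx mulr1n.
  apply: eq_bigr => r _.
  rewrite (_ : lift ord0 r = rshift 1 r); last exact: val_inj.
  by rewrite [X in _ * X](@row_mxEr R 1 1 d) !mxE.
transitivity (\int[mu]_(t in `[0, tau])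
    (if k' == 0 then tau ^+ d * cos ((k 0 0)%:~R * t + c) else 0)).
  apply: eq_Rintegral => t _; rewrite -ih; apply: torus_rint_eq => x.
  by rewrite dotE; congr cos; ring.
rewrite kE; case: (k' == 0); rewrite ?andbF ?andbT.
  rewrite RintegralZl//.
    by rewrite integral_cos; case: ifP; rewrite ?mulr0// exprSr mulrA.
  apply: integrable_itv => t; apply: continuous_comp; last exact: continuous_cos.
  by apply: cvgD; [apply: cvgM; [exact: cvg_cst|exact: cvg_id]|exact: cvg_cst].
by rewrite Rintegral_cst// mul0r.
Qed.

End TorusReal.

(** * Fourier coefficients of products *)

Section TorusComplex.
Set Implicit Arguments.
Unset Strict Implicit.
Unset Printing Implicit Defensive.
Variables (R : realType) (d : nat).
Local Open Scope complex_scope.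
Local Notation C := R[i].
Local Notation Re := (@complex.Re R).
Local Notation Im := (@complex.Im R).
Local Notation tau := (2 * @pi R).
Implicit Types (f g : 'rV[R]_d -> C).

Definition cucont f := ucont (fun x => Re (f x)) /\ ucont (fun x => Im (f x)).

Lemma cucontM f g (A B : R) : cucont f -> cucont g ->
  (forall x, normc (f x) <= A) -> (forall x, normc (g x) <= B) ->
  cucont (fun x => f x * g x).
Proof.
move=> [f1 f2] [g1 g2] fA gB.
have a1 x : `|Re (f x)| <= A := le_trans (Re_le_normc _) (fA x).
have a2 x : `|Im (f x)| <= A := le_trans (Im_le_normc _) (fA x).
have b1 x : `|Re (g x)| <= B := le_trans (Re_le_normc _) (gB x).
have b2 x : `|Im (g x)| <= B := le_trans (Im_le_normc _) (gB x).
have e1 : (fun x => Re (f x * g x)) = (fun x => Re (f x) * Re (g x) - Im (f x) * Im (g x)).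
  by apply/funext => x; case: (f x) (g x) => ? ? [].
have e2 : (fun x => Im (f x * g x)) = (fun x => Re (f x) * Im (g x) + Im (f x) * Re (g x)).
  by apply/funext => x; case: (f x) (g x) => ? ? [].
split; [rewrite e1; apply: ucontB|rewrite e2; apply: ucontD]; exact: ucontM.
Qed.

Lemma cucontZ f (c : C) : cucont f -> cucont (fun x => c * f x).
Proof.
move=> [f1 f2]; case: c => a b; split.
  have -> : (fun x => Re ((a +i* b) * f x)) = (fun x => a * Re (f x) - b * Im (f x)).
    by apply/funext => x; case: (f x).
  by apply: ucontB; exact: ucontZ.
have -> : (fun x => Im ((a +i* b) * f x)) = (fun x => a * Im (f x) + b * Re (f x)).
  by apply/funext => x; case: (f x).
by apply: ucontD; exact: ucontZ.
Qed.

Lemma torus_intD f g : cucont f -> cucont g ->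
  torus_int (fun x => f x + g x) = torus_int f + torus_int g.
Proof.
move=> [f1 f2] [g1 g2]; rewrite /torus_int; congr Complex; rewrite -torus_rintD//;
  by apply: torus_rint_eq => x; case: (f x) (g x) => ? ? [].
Qed.

Lemma torus_intZ f (c : C) : cucont f ->
  torus_int (fun x => c * f x) = c * torus_int f.
Proof.
move=> [f1 f2]; case: c => a b; rewrite /torus_int; congr Complex.
  rewrite -!torus_rintZ// -torus_rintB; try exact: ucontZ.
  by apply: torus_rint_eq => x; case: (f x).
rewrite -!torus_rintZ// -torus_rintD; try exact: ucontZ.
by apply: torus_rint_eq => x; case: (f x).
Qed.

Lemma cucont_csum (I : choiceType) (f : I -> 'rV[R]_d -> C) (b : I -> R) :
  rsummable b -> (forall i, cucont (f i)) -> (forall i x, normc (f i x) <= b i) ->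
  cucont (fun x => csum setT (fun i => f i x)).
Proof.
move=> bs uf fb; split; apply: (ucont_rsum bs).
- by move=> i; have [] := uf i.
- by move=> i x; apply: le_trans (Re_le_normc _) _.
- by move=> i; have [] := uf i.
- by move=> i x; apply: le_trans (Im_le_normc _) _.
Qed.

Lemma torus_int_csum (I : choiceType) (f : I -> 'rV[R]_d -> C) (b : I -> R) :
  rsummable b -> (forall i, cucont (f i)) -> (forall i x, normc (f i x) <= b i) ->
  torus_int (fun x => csum setT (fun i => f i x)) = csum setT (fun i => torus_int (f i)).
Proof.
move=> bs uf fb; rewrite /torus_int /csum; congr Complex => /=;
  apply: (torus_rint_rsum bs).
- by move=> i; have [] := uf i.
- by move=> i x; apply: le_trans (Re_le_normc _) _.
- by move=> i; have [] := uf i.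
- by move=> i x; apply: le_trans (Im_le_normc _) _.
Qed.

Lemma torus_int_eq f g : f =1 g -> torus_int f = torus_int g.
Proof. by move=> /funext ->. Qed.

Lemma cucont_cst (c : C) : cucont (fun _ => c).
Proof. by split; exact: ucont_cst. Qed.

Lemma cucontD f g : cucont f -> cucont g -> cucont (fun x => f x + g x).
Proof.
move=> [f1 f2] [g1 g2]; split.
  have := ucontD f1 g1; congr ucont; apply/funext => x.
  by case: (f x) (g x) => ? ? [].
have := ucontD f2 g2; congr ucont; apply/funext => x.
by case: (f x) (g x) => ? ? [].
Qed.

Lemma torus_int_sum (I : Type) (s : seq I) (f : I -> 'rV[R]_d -> C) :
  (forall i, cucont (f i)) ->
  torus_int (fun x => \sum_(i <- s) f i x) = \sum_(i <- s) torus_int (f i).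
Proof.
move=> uf; suff [] : cucont (fun x => \sum_(i <- s) f i x) /\
  torus_int (fun x => \sum_(i <- s) f i x) = \sum_(i <- s) torus_int (f i) by [].
elim: s => [|i s [ih1 ih2]].
  under eq_fun do rewrite big_nil; rewrite big_nil; split; first exact: cucont_cst.
  by rewrite /torus_int torus_rint0.
under eq_fun do rewrite big_cons; rewrite big_cons; split; first exact: cucontD.
by rewrite torus_intD// ih2.
Qed.

Definition enorm : R := (tau `^ (- (d%:R / 2))).

Lemma enorm_gt0 : 0 < enorm.
Proof. by rewrite powR_gt0// mulr_gt0// pi_gt0. Qed.

Lemma enorm_sqr : enorm * enorm * tau ^+ d = 1.
Proof.
have t0 : 0 < tau by rewrite mulr_gt0// pi_gt0.
rewrite /enorm -powRD ?(gt_eqF t0) ?implybT// -opprD -splitr powRN powR_mulrn ?ltW//.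
by rewrite mulVf// expf_neq0// gt_eqF.
Qed.

Implicit Types h k l : 'rV[int]_d.

Implicit Types x : 'rV[R]_d.

Lemma fourier_eE k x :
  fourier_e k x = enorm%:C * (cos (dot (rvec R k) x) +i* sin (dot (rvec R k) x)).
Proof. by []. Qed.

Lemma dot_rvecD k l x : dot (rvec R (k + l)) x = dot (rvec R k) x + dot (rvec R l) x.
Proof.
by rewrite /dot -big_split/=; apply: eq_bigr => r _; rewrite !mxE rmorphD mulrDl.
Qed.

Lemma dot_rvecN k x : dot (rvec R (- k)) x = - dot (rvec R k) x.
Proof.
by rewrite /dot -sumrN; apply: eq_bigr => r _; rewrite !mxE rmorphN mulNr.
Qed.

Lemma normc_fourier_e k x : normc (fourier_e k x) = enorm.
Proof.
rewrite fourier_eE normcM normcR /= cos2Dsin2 sqrtr1 mulr1.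
by rewrite ger0_norm// ltW// enorm_gt0.
Qed.

Lemma fourier_e_conj k x : conjc (fourier_e k x) = fourier_e (- k) x.
Proof.
rewrite !fourier_eE dot_rvecN cosN sinN rmorphM /=; congr (_ * _).
by rewrite oppr0.
Qed.

Lemma fourier_e_mul k l x : fourier_e k x * fourier_e l x = enorm%:C * fourier_e (k + l) x.
Proof.
rewrite !fourier_eE dot_rvecD cosD sinD mulrACA -mulrA; congr (_ * _).
by congr (_ * _); congr Complex; rewrite addrC.
Qed.

Lemma cucont_fourier_e k : cucont (fourier_e k).
Proof.
apply: cucontZ; split => /=.
  have := ucont_cos k (0 : R); congr ucont; apply/funext => x.
  by rewrite addr0.
have := ucont_cos k (- (pi / 2) : R); congr ucont; apply/funext => x.
by rewrite cosBpihalf.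
Qed.

Lemma torus_int_fourier_e k : torus_int (fourier_e k) =
  if k == 0 then (enorm * tau ^+ d)%:C else 0.
Proof.
rewrite torus_intZ; last first.
  split => /=.
    have := ucont_cos k (0 : R); congr ucont; apply/funext => x.
    by rewrite addr0.
  have := ucont_cos k (- (pi / 2) : R); congr ucont; apply/funext => x.
  by rewrite cosBpihalf.
have -> : torus_int (fun x => cos (dot (rvec R k) x) +i* sin (dot (rvec R k) x)) =
    if k == 0 then (tau ^+ d)%:C else 0.
  rewrite /torus_int /=.
  have -> : torus_rint (fun x => cos (dot (rvec R k) x)) = if k == 0 then tau ^+ d else 0.
    transitivity (torus_rint (fun x => cos (dot (rvec R k) x + 0))).
      by apply: torus_rint_eq => x; rewrite addr0.
    by rewrite torus_rint_cos cos0 mulr1.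
  have -> : torus_rint (fun x => sin (dot (rvec R k) x)) = 0.
    transitivity (torus_rint (fun x => cos (dot (rvec R k) x + - (pi / 2)))).
      by apply: torus_rint_eq => x; rewrite cosBpihalf.
    by rewrite torus_rint_cos cosN cos_pihalf mulr0; case: ifP.
  by case: ifP.
by case: ifP; rewrite ?mulr0// rmorphM.
Qed.

Lemma fourier_orthonormal k l :
  torus_int (fun x : 'rV[R]_d => conjc (fourier_e k x) * fourier_e l x) = (k == l)%:R.
Proof.
transitivity (torus_int (fun x => enorm%:C * fourier_e (l - k) x)).
  by apply: torus_int_eq => x; rewrite fourier_e_conj fourier_e_mul addrC.
rewrite torus_intZ; last exact: cucont_fourier_e.
rewrite torus_int_fourier_e subr_eq0 eq_sym; case: eqP => _; last by rewrite mulr0.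
by rewrite -rmorphM/= mulrA enorm_sqr.
Qed.

Section Convolution.
Variables (a b : 'rV[int]_d -> C).
Hypotheses (sa : csummable a) (sb : csummable b).

Let term_bound (c : 'rV[int]_d -> C) l x : normc (c l * fourier_e l x) <= enorm * normc (c l).
Proof. by rewrite normcM normc_fourier_e mulrC. Qed.

Let cucont_series : cucont (fourier_series b).
Proof.
apply: (cucont_csum (rsummableZ enorm sb)) => [l|l x]; last exact: term_bound.
by apply: cucontZ; exact: cucont_fourier_e.
Qed.

Let series_bound x : normc (fourier_series b x) <= rsum setT (fun l => enorm * normc (b l)).
Proof.
by apply: normc_csum_le (rsummableZ enorm sb) _ => l; exact: term_bound.
Qed.

Let cucont_conj_e k : cucont (fun x => conjc (fourier_e k x)).
Proof.
have := cucont_fourier_e (- k); congr cucont; apply/funext => x.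
by rewrite fourier_e_conj.
Qed.

Lemma fourier_coef_series k : fourier_coef (fourier_series b) k = b k.
Proof.
rewrite /fourier_coef.
transitivity (torus_int (fun x => csum setT (fun l => b l * (conjc (fourier_e k x) * fourier_e l x)))).
  apply: torus_int_eq => x; rewrite /fourier_series -csumZ; last first.
    by apply: csummable_le (rsummableZ enorm sb) _ => l; exact: term_bound.
  by apply: csum_eq => l; rewrite mulrCA.
have ce l : cucont (fun x => conjc (fourier_e k x) * fourier_e l x).
  apply: (@cucontM _ _ enorm enorm); [exact: cucont_conj_e|exact: cucont_fourier_e|..] => x.
    by rewrite normcJ' normc_fourier_e.
  by rewrite normc_fourier_e.
rewrite (torus_int_csum (rsummableZ (enorm * enorm) sb)).
- rewrite (csum_single (a := k)) => [|l lk].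
    by rewrite torus_intZ// fourier_orthonormal eqxx mulr1.
  by rewrite torus_intZ// fourier_orthonormal eq_sym (negbTE lk) mulr0.
- by move=> l; exact: cucontZ.
- by move=> l x; rewrite 2!normcM normcJ' !normc_fourier_e mulrC.
Qed.

Lemma cucont_seriesM : cucont (fun x => fourier_series a x * fourier_series b x).
Proof.
apply: (cucontM (A := rsum setT (fun l => enorm * normc (a l))) _ cucont_series _ series_bound).
  apply: (cucont_csum (rsummableZ enorm sa)) => [l|l x]; last exact: term_bound.
  by apply: cucontZ; exact: cucont_fourier_e.
by move=> x; apply: normc_csum_le (rsummableZ enorm sa) _ => l; exact: term_bound.
Qed.

(** Expand only the first series and integrate termwise: multiplication by
    e_h shifts the Fourier coefficients of the second factor by h. *)
Lemma fourier_coef_convolution k :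
  fourier_coef (fun x => fourier_series a x * fourier_series b x) k =
  enorm%:C * csum setT (fun h => a h * b (k - h)).
Proof.
pose B := rsum setT (fun l => enorm * normc (b l)).
have ce l : cucont (fun x => conjc (fourier_e l x) * fourier_series b x).
  apply: (@cucontM _ _ enorm B); [exact: cucont_conj_e|exact: cucont_series|..] => x.
    by rewrite normcJ' normc_fourier_e.
  exact: series_bound.
have sB x : csummable (fun h => a h * fourier_e h x).
  by apply: csummable_le (rsummableZ enorm sa) _ => l; exact: term_bound.
have sab : csummable (fun h => a h * b (k - h)).
  apply: csummable_le (rsummableZ (rsum setT (fun l => normc (b l))) sa) _ => h.
  rewrite normcM mulrC ler_wpM2r ?normc_ge0//.
  by apply: (le_term_rsum (f := fun l => normc (b l))) => // l; exact: normc_ge0.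
rewrite /fourier_coef.
transitivity (torus_int (fun x => csum setT (fun h =>
    (enorm%:C * a h) * (conjc (fourier_e (k - h) x) * fourier_series b x)))).
  apply: torus_int_eq => x; rewrite [X in _ * (X * _)]/fourier_series.
  rewrite [X in _ * X]mulrC mulrA -csumZ//.
  apply: csum_eq => h; rewrite !fourier_e_conj opprB [h - k]addrC.
  have -> : fourier_e (- k) x * fourier_series b x * (a h * fourier_e h x) =
    a h * (fourier_e (- k) x * fourier_e h x * fourier_series b x) by ring.
  by rewrite fourier_e_mul; ring.
rewrite (torus_int_csum (rsummableZ (enorm * (enorm * B)) sa)).
- rewrite -csumZ//; apply: csum_eq => h; rewrite torus_intZ// -mulrA; congr (_ * (_ * _)).
  exact: fourier_coef_series.
- by move=> h; exact: cucontZ.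
- move=> h x; rewrite !normcM normcJ' normc_fourier_e normcR ger0_norm ?(ltW enorm_gt0)//.
  have -> : enorm * (enorm * B) * normc (a h) = enorm * normc (a h) * (enorm * B) by ring.
  rewrite ler_wpM2l ?mulr_ge0 ?normc_ge0 ?(ltW enorm_gt0)//.
  by rewrite ler_wpM2l ?(ltW enorm_gt0)//; exact: series_bound.
Qed.

End Convolution.
End TorusComplex.

(** * The Kato inequality *)

Section Kato.
Set Implicit Arguments.
Unset Strict Implicit.
Unset Printing Implicit Defensive.
Variables (R : realType) (d : nat).
Local Open Scope complex_scope.
Local Notation C := R[i].
Local Notation Re := (@complex.Re R).
Local Notation vcoefs := ('rV[int]_d -> 'rV[C]_d).
Implicit Types (v w : vcoefs) (k h : 'rV[int]_d) (m s : R).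

Lemma mem_Z0 k : (k \in Z0) = (k != 0).
Proof. by apply/idP/idP => [/set_mem|/mem_set]. Qed.

(** The H^m norm of v is the l2 norm of [wt m v]. *)
Definition wt m v k : R := znorm R k `^ m * vnorm (v k).

Lemma wt_ge0 m v k : 0 <= wt m v k.
Proof. by rewrite mulr_ge0 ?powR_ge0 ?vnorm_ge0. Qed.

Lemma wt_sqr m v k : wt m v k ^+ 2 = znorm R k `^ (2 * m) * vnorm (v k) ^+ 2.
Proof. by rewrite exprMn [2 * m]mulrC powRrM powR_mulrn// powR_ge0. Qed.

Lemma wt1E v k : wt 1 v k = znorm R k * vnorm (v k).
Proof. by rewrite /wt powRr1 ?znorm_ge0. Qed.

Lemma HH_summable m v : HH m v -> rsummable (fun k => wt m v k ^+ 2).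
Proof.
move=> [_ _ v0 +]; rewrite esum_mkcond; apply: le_lt_trans; apply: le_esum => k _ /=.
rewrite ger0_norm ?sqr_ge0// wt_sqr; rewrite mem_Z0; case: eqVneq => //= ->.
by rewrite v0 vnorm0 expr0n mulr0.
Qed.

Lemma hnormE m v : v 0 = 0 ->
  hnorm m v = Num.sqrt (rsum setT (fun k => wt m v k ^+ 2)).
Proof.
move=> v0; rewrite /hnorm /hdot csum_masked => [|k /negP/negPn/eqP ->]; last first.
  by rewrite v0 dot_conjv_self vnorm0 expr0n mulr0.
congr Num.sqrt; apply: rsum_eq => k.
by rewrite dot_conjv_self -rmorphM wt_sqr.
Qed.

Lemma hnorm_ge0 m v : 0 <= hnorm m v.
Proof. exact: sqrtr_ge0. Qed.

Lemma wt_le m m' v k : v 0 = 0 -> m <= m' -> wt m v k <= wt m' v k.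
Proof.
move=> v0 mm; have [->|k0] := eqVneq k 0; first by rewrite /wt v0 vnorm0 !mulr0.
by rewrite ler_wpM2r ?vnorm_ge0// ler_powR// znorm_ge1.
Qed.

Lemma wt_summable_le m m' v : v 0 = 0 -> m <= m' ->
  rsummable (fun k => wt m' v k ^+ 2) -> rsummable (fun k => wt m v k ^+ 2).
Proof.
move=> v0 mm s; apply: rsummable_le s _ => k.
by rewrite ger0_norm ?sqr_ge0// lerXn2r ?nnegrE ?wt_ge0// wt_le.
Qed.

Definition zeta_term s k : R := if k == 0 then 0 else (znorm R k `^ s)^-1.

Lemma zeta_term_ge0 s k : 0 <= zeta_term s k.
Proof. by rewrite /zeta_term; case: ifP; rewrite // invr_ge0 powR_ge0. Qed.

Lemma zetaE s : (0 < d)%N -> d%:R < s -> zeta d s = rsum setT (zeta_term s).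
Proof.
move=> d0 ds; have zs : rsummable (zeta_term s) by exact: rsummable_zeta.
apply: EFin_inj; rewrite (rsum_esum (zeta_term_ge0 s) zs) /zeta esum_mkcond.
have E : \esum_(k in [set: 'rV[int]_d]) (if k \in Z0 then ((znorm R k `^ s)^-1)%:E else 0%E)
    = \esum_(k in [set: 'rV[int]_d]) (zeta_term s k)%:E.
  apply: eq_esum => k _; rewrite /zeta_term.
  by rewrite mem_Z0; case: eqVneq.
by rewrite E -(rsum_esum (zeta_term_ge0 s) zs).
Qed.

(** Sobolev embedding of H^n in the fields whose gradient has absolutely
    summable Fourier coefficients. Cauchy-Schwarz with the weights |k|^(1 - n)
    proves it, and this is the origin of zeta. *)
Lemma wt1_summable n v : (0 < d)%N -> d%:R / 2 + 1 < n -> v 0 = 0 ->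
  rsummable (fun k => wt n v k ^+ 2) ->
  rsummable (wt 1 v) /\
  rsum setT (wt 1 v) <= Num.sqrt (zeta d (2 * n - 2)) * hnorm n v.
Proof.
move=> d0 nd v0 vs; have ds : d%:R < 2 * n - 2 by lra.
pose z k := if k == 0 then 0 else (znorm R k `^ (n - 1))^-1.
have zE : (fun k => z k ^+ 2) = zeta_term (2 * n - 2).
  apply/funext => k; rewrite /z /zeta_term; case: ifP => _; first by rewrite expr0n.
  rewrite exprVn -powR_mulrn ?powR_ge0// -powRrM; congr (_ `^ _)^-1; ring.
have zs : rsummable (fun k => z k ^+ 2) by rewrite zE; exact: rsummable_zeta.
have wE : wt 1 v = (fun k => z k * wt n v k).
  apply/funext => k; rewrite /z; case: eqVneq => [->|k0].
    by rewrite /wt v0 vnorm0 mulr0 mul0r.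
  have k1 := znorm_ge1 R k0; have k0' : znorm R k != 0 by rewrite gt_eqF//; lra.
  rewrite /wt mulrA; congr (_ * _).
  by rewrite -powRN -powRD ?k0' ?implybT//; congr (_ `^ _); ring.
rewrite wE; split; first exact: rsummableM_sqr.
apply: le_trans (rsum_cauchy_schwarz zs vs) _.
by rewrite hnormE// zE zetaE.
Qed.

Lemma vnorm_summable v : v 0 = 0 -> rsummable (wt 1 v) -> rsummable (fun k => vnorm (v k)).
Proof.
move=> v0 s; apply: rsummable_le s _ => k.
rewrite ger0_norm ?vnorm_ge0//; have := wt_le k v0 (@ler01 R).
by rewrite {1}/wt powRr0 mul1r.
Qed.

Lemma dotC (K : comPzRingType) (a b : 'rV[K]_d) : dot a b = dot b a.
Proof. by apply: eq_bigr => r _; rewrite mulrC. Qed.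

Lemma dotDr (K : pzRingType) (a b c : 'rV[K]_d) : dot a (b + c) = dot a b + dot a c.
Proof. by rewrite -big_split/=; apply: eq_bigr => r _; rewrite mxE mulrDr. Qed.

Lemma dotNr (K : pzRingType) (a b : 'rV[K]_d) : dot a (- b) = - dot a b.
Proof. by rewrite -sumrN; apply: eq_bigr => r _; rewrite mxE mulrN. Qed.

Lemma conjvK : involutive (@conjv R d).
Proof. by move=> a; apply/rowP => r; rewrite !mxE conjcK. Qed.

(** The absolute convergence of both series makes the pointwise product in
    the definition of the advection a convolution of Fourier coefficients. *)
Lemma advectE v w k (s : 'I_d) : rsummable (fun k => vnorm (v k)) -> rsummable (wt 1 w) ->
  csummable (fun h => 'i * dot (v h) (zvec R (k - h)) * w (k - h) 0 s) /\
  advect v w k 0 s = (enorm R d)%:C *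
    csum setT (fun h => 'i * dot (v h) (zvec R (k - h)) * w (k - h) 0 s).
Proof.
move=> sv sw.
have sa r : csummable (Defs.coord v r).
  by apply: csummable_le sv _ => h; exact: vnorm_coord.
have sb r : csummable (partial r (Defs.coord w s)).
  apply: csummable_le sw _ => l; rewrite /partial /Defs.coord normcM /wt powRr1 ?znorm_ge0//.
  apply: ler_pM; rewrite ?normc_ge0//; last exact: vnorm_coord.
  have := vnorm_coord (zvec R l) r; rewrite mxE /znorm; apply: le_trans.
  rewrite -[X in _ <= normc X](rmorph_int (real_complex R)) normcR /=.
  by rewrite expr0n add0r sqrtr_sqr.
pose f r h := Defs.coord v r h * partial r (Defs.coord w s) (k - h).
have sf r : csummable (f r).
  apply: csummable_le (rsummableZ (rsum setT (fun l => normc (partial r (Defs.coord w s) l))) (sa r)) _ => h.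
  rewrite normcM mulrC ler_wpM2r ?normc_ge0//.
  apply: (le_term_rsum (f := fun l => normc (partial r (Defs.coord w s) l))); last exact: sb.
  by move=> l; exact: normc_ge0.
have [sS sE] := csum_sum sf.
have fE : (fun h => \sum_r f r h) =
    (fun h => 'i * dot (v h) (zvec R (k - h)) * w (k - h) 0 s).
  apply/funext => h; rewrite /dot mulr_sumr mulr_suml; apply: eq_bigr => r _.
  rewrite /f /partial /Defs.coord.
  have -> : (0 +i* ((k - h) 0 r)%:~R : C) = 'i * zvec R (k - h) 0 r.
    rewrite [zvec R _ 0 r]mxE -[X in 'i * X](rmorph_int (real_complex R)) /=.
    by congr Complex; rewrite !mul0r ?mulr0 ?mul1r ?subrr ?addr0 ?add0r.
  by ring.
rewrite -fE; split => //.
rewrite mxE /fourier_coef sE mulr_sumr.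
transitivity (torus_int (fun x => \sum_(r < d) (conjc (fourier_e k x) *
    (fourier_series (Defs.coord v r) x * fourier_series (partial r (Defs.coord w s)) x)))).
  by apply: torus_int_eq => x; rewrite mulr_sumr.
rewrite torus_int_sum => [|r].
  by apply: eq_bigr => r _; rewrite -fourier_coef_convolution.
apply: (@cucontM _ _ _ _ (enorm R d) (rsum setT (fun l => enorm R d * normc (Defs.coord v r l)) *
   rsum setT (fun l => enorm R d * normc (partial r (Defs.coord w s) l)))).
- have := cucont_fourier_e R (- k); congr cucont; apply/funext => x.
  by rewrite fourier_e_conj.
- exact: cucont_seriesM.
- by move=> x; rewrite normcJ' normc_fourier_e.
- move=> x; rewrite normcM; apply: ler_pM; rewrite ?normc_ge0//.
    apply: normc_csum_le (rsummableZ (enorm R d) (sa r)) _ => l.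
    by rewrite normcM normc_fourier_e mulrC.
  apply: normc_csum_le (rsummableZ (enorm R d) (sb r)) _ => l.
  by rewrite normcM normc_fourier_e mulrC.
Qed.

(** The interaction of the modes h of v and k - h of w with the mode k of w,
    for z = (k, h), up to the factor in front of the sum in [dot_PP]. *)
Definition tri v w (z : 'rV[int]_d * 'rV[int]_d) : C :=
  conjc (dot (v z.2) (zvec R (z.1 - z.2))) * dot (conjv (w (z.1 - z.2))) (w z.1).

Lemma normc_tri_le v w z : normc (tri v w z) <=
  vnorm (v z.2) * wt 1 w (z.1 - z.2) * vnorm (w z.1).
Proof.
rewrite normcM normcJ' /wt powRr1 ?znorm_ge0// mulrA -mulrA.
apply: ler_pM; rewrite ?normc_ge0//; first exact: normc_dot_le.
by apply: le_trans (normc_dot_le _ _) _; rewrite vnorm_conjv.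
Qed.

(** The Leray projection disappears because it subtracts a multiple of k, and
    k is orthogonal to w_k. *)
Lemma dot_PP v w k : rsummable (fun k => vnorm (v k)) -> rsummable (wt 1 w) ->
  dot (zvec R k) (w k) = 0 -> w 0 = 0 ->
  dot (conjv (PP v w k)) (w k) =
  conjc ((enorm R d)%:C * 'i) * csum setT (fun h => tri v w (k, h)).
Proof.
move=> sv sw kw w0.
have [k0|k0] := eqVneq k 0.
  rewrite k0 w0 (_ : csum _ _ = 0).
    by rewrite mulr0 /dot big1// => r _; rewrite [X in _ * X]mxE mulr0.
  rewrite -[RHS](csum0 R 'rV[int]_d); apply: csum_eq => h.
  by rewrite /tri /= w0 /dot [X in _ * X]big1 ?mulr0// => r _; rewrite [X in _ * X]mxE mulr0.
have -> : dot (conjv (PP v w k)) (w k) = dot (conjv (advect v w k)) (w k).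
  rewrite /PP /leray (negbTE k0); set c := _ / _.
  have -> : dot (conjv (advect v w k - c *: zvec R k)) (w k) =
      dot (conjv (advect v w k)) (w k) - conjc c * dot (zvec R k) (w k).
    move: (advect v w k) => a; rewrite /dot mulr_sumr -sumrB; apply: eq_bigr => r _.
    by rewrite !mxE rmorphB rmorphM /= rmorph_int; ring.
  by rewrite kw mulr0 subr0.
have F (s : 'I_d) := advectE k s sv sw.
have cF (s : 'I_d) : csummable (fun h => w k 0 s * conjc ('i * dot (v h) (zvec R (k - h)) * w (k - h) 0 s)).
  by apply: csummableZ; apply: csummable_conj; have [] := F s.
have cE : (fun h => conjc 'i * tri v w (k, h)) =
    (fun h => \sum_s w k 0 s * conjc ('i * dot (v h) (zvec R (k - h)) * w (k - h) 0 s)).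
  apply/funext => h.
  have gen (j : C) : conjc j * tri v w (k, h) =
      \sum_s w k 0 s * conjc (j * dot (v h) (zvec R (k - h)) * w (k - h) 0 s).
    rewrite /tri /= mulrA -rmorphM /= [dot (conjv _) _]/dot mulr_sumr.
    by apply: eq_bigr => s _; rewrite mxE [in RHS]rmorphM /=; ring.
  exact: gen.
have [c1 c2] := csum_sum cF.
have ct : csummable (fun h => tri v w (k, h)).
  have -> : (fun h => tri v w (k, h)) = (fun h => 'i * (conjc 'i * tri v w (k, h))).
    apply/funext => h; rewrite mulrA -sqr_normc normc_def /= expr0n expr1n add0r sqrtr1.
    by rewrite expr1n mul1r.
  by apply: csummableZ; rewrite cE.
have cM (x y : C) : conjc (x * y) = conjc x * conjc y by exact: rmorphM.
rewrite cM -mulrA -csumZ// cE c2 [LHS]/dot mulr_sumr; apply: eq_bigr => s _.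
have [f1 f2] := F s.
rewrite mxE f2 cM csumZ ?csum_conj//; last exact: csummable_conj.
by rewrite -mulrA [_ * w k 0 s]mulrC.
Qed.

Lemma normc_real_complexM (x : R) (z : C) : normc (x%:C * z) = `|x| * normc z.
Proof. by rewrite normcM normcR. Qed.

Let shift_algebra (X Y y y1 V W Wk : R) : y * Y = y1 ->
  X * Y * (V * (y * W) * Wk) = V * (y1 * W) * (X * Wk).
Proof. by move=> <-; ring. Qed.

Let weight_algebra (K X z zp zq y yp yq V W Wk : R) : z * zq = zp -> y * yq = yp ->
  X * (K * z * (zq + yq)) * (V * (y * W) * Wk) =
  K * ((y * W) * (zp * V) * (X * Wk) + (z * V) * (yp * W) * (X * Wk)).
Proof. by move=> <- <-; ring. Qed.

Let antisym_algebra (X Y : R) (a b : C) :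
  (Y * X)%:C * (- a * b) = - ((X * Y)%:C * (a * b)).
Proof. by rewrite [Y * X]mulrC mulNr mulrN. Qed.

Section Estimate.
Variables (p n : R) (v w : vcoefs).
Hypotheses (d_gt0 : (0 < d)%N) (n_gt : d%:R / 2 + 1 < n) (np : n <= p).
Hypotheses (Hv : HH p v) (Hw : HH (p + 1) w).

Let n1 : 1 <= n. Proof. by have := ler0n R d; have := n_gt; lra. Qed.
Let p1 : 1 <= p. Proof. by have := n1; have := np; lra. Qed.
Let v0 : v 0 = 0. Proof. by case: Hv. Qed.
Let w0 : w 0 = 0. Proof. by case: Hw. Qed.
Let div_v k : dot (zvec R k) (v k) = 0. Proof. by case: Hv. Qed.
Let div_w k : dot (zvec R k) (w k) = 0. Proof. by case: Hw. Qed.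
Let vp : rsummable (fun k => wt p v k ^+ 2). Proof. exact: HH_summable. Qed.
Let wp1 : rsummable (fun k => wt (p + 1) w k ^+ 2). Proof. exact: HH_summable. Qed.
Let wp : rsummable (fun k => wt p w k ^+ 2).
Proof. by apply: wt_summable_le wp1 => //; lra. Qed.
Let v1 := wt1_summable d_gt0 n_gt v0 (wt_summable_le v0 np vp).
Let w1 := wt1_summable d_gt0 n_gt w0 (wt_summable_le w0 np wp).
Let sv := vnorm_summable v0 v1.1.

(** The part of |k|^(2 p) tri that represents the advection of |D|^p w by v,
    tested against |D|^p w. *)
Let T (z : 'rV[int]_d * 'rV[int]_d) : C :=
  (znorm R z.1 `^ p * znorm R (z.1 - z.2) `^ p)%:C * tri v w z.
(** What is left: the commutator of |D|^p with the advection by v. *)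
Let D (z : 'rV[int]_d * 'rV[int]_d) : C :=
  (znorm R z.1 `^ p * (znorm R z.1 `^ p - znorm R (z.1 - z.2) `^ p))%:C * tri v w z.

Let T_summable : csummable T.
Proof.
have [s _] := young_trilinear (fun k => vnorm_ge0 (v k)) (wt_ge0 (p + 1) w) (wt_ge0 p w) sv wp1 wp.
apply: csummable_le s _ => -[k h] /=.
rewrite normc_real_complexM ger0_norm ?mulr_ge0 ?powR_ge0//=.
apply: le_trans (ler_wpM2l _ (normc_tri_le _ _ _)) _; first by rewrite mulr_ge0 ?powR_ge0.
have pp : 0 < p + 1 by have := p1; lra.
have E : znorm R (k - h) * znorm R (k - h) `^ p = znorm R (k - h) `^ (p + 1).
  by rewrite -[in LHS](addrK 1 p) mulr_powRB1 ?znorm_ge0.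
rewrite /= wt1E /wt le_eqVlt; apply/orP; left; apply/eqP.
exact: shift_algebra.
Qed.

(** Advection by a divergence-free field is antisymmetric. On the Fourier side
    the involution (k, h) -> (h - k, h) changes the sign of T, by reality of w
    and since h is orthogonal to v_h. *)
Let T_sum : csum setT T = 0.
Proof.
pose e (z : 'rV[int]_d * 'rV[int]_d) := (z.2 - z.1, z.2).
have be : bijective e.
  by exists e => -[k h]; rewrite /e /= opprB addrCA subrr addr0.
have Te z : T (e z) = - T z.
  case: z => k h; rewrite /T /tri /e /=.
  have -> : h - k - h = - k by rewrite addrAC subrr add0r.
  have [wr _ _ _] := Hw.
  (* v_h is orthogonal to h, so k and k - h have the same product with it. *)
  have E : dot (v h) (zvec R (- k)) = - dot (v h) (zvec R (k - h)).
    rewrite zvecN dotNr; congr (- _).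
    have <- : dot (v h) (zvec R (k - h)) + dot (v h) (zvec R h) = dot (v h) (zvec R k).
      by rewrite -dotDr -zvecD subrK.
    by rewrite [dot (v h) (zvec R h)]dotC div_v addr0.
  have {1}-> : h - k = - (k - h) by rewrite opprB.
  rewrite E rmorphN /= -(opprB k h) !wr conjvK !znormN.
  rewrite [dot (w k) _]dotC; exact: antisym_algebra.
have : csum setT T = - csum setT T.
  rewrite {1}(csum_reindex _ be) -csumN//.
  by apply: csum_eq.
move=> /eqP; rewrite -addr_eq0 -mulr2n -mulr_natr mulf_eq0 pnatr_eq0 orbF => /eqP //.
Qed.

Let K := p * 2 `^ (p - 1).

Let K0 : 0 <= K.
Proof. by rewrite mulr_ge0 ?powR_ge0//; have := p1; lra. Qed.

(** Distributing the p derivatives falling on v and w: in the first term v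
    carries them all, in the second w does. *)
Let G (z : 'rV[int]_d * 'rV[int]_d) : R :=
  K * (wt 1 w (z.1 - z.2) * wt p v z.2 * wt p w z.1 +
       wt 1 v z.2 * wt p w (z.1 - z.2) * wt p w z.1).

Let D_le z : normc (D z) <= G z.
Proof.
case: z => k h; rewrite /D /G /= normc_real_complexM normrM ger0_norm ?powR_ge0//.
have pp : 0 < p by have := p1; lra.
have comm := powR_commutator (znorm_ge0 R k) (znorm_ge0 R (k - h)) (znorm_ge0 R h) p1 (znorm_sub_le R k h).
apply: (@le_trans _ _ (znorm R k `^ p * (K * znorm R h * (znorm R h `^ (p - 1) + znorm R (k - h) `^ (p - 1))) *
   (vnorm (v h) * wt 1 w (k - h) * vnorm (w k)))).
  apply: ler_pM; rewrite ?mulr_ge0 ?powR_ge0 ?normc_ge0//; last exact: normc_tri_le.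
  by apply: ler_wpM2l; rewrite ?powR_ge0.
rewrite !wt1E /wt le_eqVlt; apply/orP; left; apply/eqP.
by apply: weight_algebra; exact: mulr_powRB1 (znorm_ge0 _ _) pp.
Qed.

Let G_sum : rsummable G /\ rsum setT G <=
  K * (Num.sqrt (zeta d (2 * n - 2)) * (hnorm p v * hnorm n w + hnorm n v * hnorm p w) * hnorm p w).
Proof.
have [s1 e1] := young_trilinear_swap (wt_ge0 1 w) (wt_ge0 p v) (wt_ge0 p w) w1.1 vp wp.
have [s2 e2] := young_trilinear (wt_ge0 1 v) (wt_ge0 p w) (wt_ge0 p w) v1.1 wp wp.
rewrite -!hnormE// in e1 e2.
have s12 := rsummableD s1 s2; split; first exact: rsummableZ.
rewrite rsumZ// ler_wpM2l// rsumD//; apply: le_trans (lerD e1 e2) _.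
have := w1.2; have := v1.2.
move: (rsum setT (wt 1 w)) (rsum setT (wt 1 v)) (Num.sqrt _) => a b c bv aw.
have := hnorm_ge0 p v; have := hnorm_ge0 p w.
move: (hnorm p v) (hnorm p w) aw bv => V W aw bv W0 V0.
rewrite -mulrDl ler_wpM2r// mulrDr lerD//.
  by rewrite mulrCA [leRHS]mulrC ler_wpM2r.
by rewrite mulrA ler_wpM2r.
Qed.

Lemma kato_estimate : normc (hdot p (PP v w) w) <=
  enorm R d * (K * (Num.sqrt (zeta d (2 * n - 2)) * (hnorm p v * hnorm n w + hnorm n v * hnorm p w) * hnorm p w)).
Proof.
have [sG leG] := G_sum.
have tri0 h : tri v w (0, h) = 0.
  by rewrite /tri /= w0 /dot [X in _ * X]big1 ?mulr0// => r _; rewrite [X in _ * X]mxE mulr0.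
have sD : csummable D := csummable_le sG D_le.
pose c := conjc ((enorm R d)%:C * 'i : C).
have -> : hdot p (PP v w) w = c * csum setT D.
  have -> : csum setT D = csum setT (fun z => T z + D z) by rewrite csumD// T_sum add0r.
  have sTD := csummableD T_summable sD.
  rewrite -csum_fubini// -csumZ; last exact: (csummable_csum sTD).
  rewrite /hdot csum_masked => [|k /negP/negPn/eqP ->]; last first.
    rewrite w0 /dot big1 ?mulr0// => r _.
    by rewrite [X in _ * X]mxE mulr0.
  apply: csum_eq => k.
  rewrite dot_PP//; last exact: w1.1.
  rewrite mulrCA; congr (_ * _).
  have E : (fun h => T (k, h) + D (k, h)) = (fun h => (znorm R k `^ (2 * p))%:C * tri v w (k, h)).
    apply/funext => h; rewrite /T /D /= -mulrDl -rmorphD /= -mulrDr addrC subrK; congr (_%:C * _).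
    by rewrite -expr2 -powR_mulrn ?powR_ge0// -powRrM mulrC.
  have tri_row : csummable (fun h => tri v w (k, h)).
    have [->|k0] := eqVneq k 0; first by under eq_fun do rewrite tri0; exact: csummable0.
    have kp : (znorm R k `^ (2 * p))%:C != 0 :> C.
      by rewrite (inj_eq (@complexI R) _ 0) gt_eqF// powR_gt0// (lt_le_trans ltr01)// znorm_ge1.
    have : csummable (fun h => T (k, h) + D (k, h)) by exact: (rsummable_row sTD k).
    rewrite E => /(csummableZ ((znorm R k `^ (2 * p))%:C^-1)).
    by under eq_fun do rewrite mulrA mulVf// mul1r.
  rewrite E.
  by rewrite csumZ//; exact: tri_row.
rewrite normcM /c normcJ' normcM normcR ger0_norm ?(ltW (enorm_gt0 _ _))//.
rewrite /= expr0n expr1n add0r sqrtr1 mulr1 ler_wpM2l ?(ltW (enorm_gt0 _ _))//.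
by apply: le_trans leG; exact: normc_csum_le.
Qed.

End Estimate.
End Kato.

(** * The sharp constant *)

Section Sharp.
Set Implicit Arguments.
Unset Strict Implicit.
Unset Printing Implicit Defensive.
Variables (R : realType) (d : nat).
Local Open Scope complex_scope.
Local Notation C := R[i].

Lemma kato_constant_Gplus (p n : R) : (0 < d)%N -> d%:R / 2 + 1 < n -> n <= p ->
  kato_constant d p n (Gplus d p n).
Proof.
move=> d0 nd np v w Hv Hw; rewrite -normcE_Re.
apply: le_trans (kato_estimate d0 nd np Hv Hw) _.
rewrite /Gplus /enorm powRN.
have -> : 2 `^ p = 2 * 2 `^ (p - 1) :> R.
  rewrite mulr_powRB1//; have := ler0n R d; lra.
rewrite le_eqVlt; apply/orP; left; apply/eqP.
move: (hnorm p w) (2 `^ (p - 1)) (Num.sqrt _) (((2 * pi) `^ _)^-1) (hnorm p v * _ + _).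
by move=> W A B E X; field.
Qed.

Section Mode.
Variables (i0 i1 : 'I_d).
Hypothesis i01 : i0 != i1.

Let k0 : 'rV[int]_d := delta_mx 0 i1.
Let u : 'rV[C]_d := delta_mx 0 i0.
Definition mode (k : 'rV[int]_d) : 'rV[C]_d :=
  if k \in [:: k0; - k0] then u else 0.

Let k0_neq0 : k0 != 0.
Proof.
apply/eqP => /(congr1 (fun k : 'rV[int]_d => k 0 i1)).
by rewrite !mxE !eqxx.
Qed.

Let k0_neqN : k0 != - k0.
Proof.
apply/eqP => /(congr1 (fun k : 'rV[int]_d => k 0 i1)).
by rewrite !mxE !eqxx.
Qed.

Let modeN k : mode (- k) = mode k.
Proof. by rewrite /mode !inE eqr_oppLR eqr_opp orbC. Qed.

(** A real shear mode, with frequency and amplitude along different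
    coordinate axes: it lies in every H^m, and exists since d >= 2. *)
Lemma mode_HH (m : R) : HH m mode.
Proof.
split.
- move=> k; rewrite modeN /mode; case: ifP => _; apply/rowP => r; rewrite !mxE.
    by rewrite rmorph_nat.
  by rewrite rmorph0.
- move=> k; rewrite /mode; case: ifP => [|_]; last first.
    by rewrite /dot big1// => r _; rewrite [X in _ * X]mxE mulr0.
  rewrite !inE => k_eq; rewrite /dot big1// => r _.
  rewrite [u 0 r]mxE eqxx /=; case: eqVneq => [->|_]; last by rewrite mulr0.
  by case/orP: k_eq => /eqP ->; rewrite !mxE (negbTE i01) ?oppr0 mul0r.
- by rewrite /mode !inE [0 == - k0]eq_sym oppr_eq0 eq_sym (negbTE k0_neq0).
- have [s _] := rsum_fset_mask (fun k => znorm R k `^ (2 * m) * vnorm u ^+ 2)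
    (A := [:: k0; - k0]) ltac:(by rewrite /= inE k0_neqN).
  rewrite esum_mkcond; apply: le_lt_trans s; apply: le_esum => k _ /=.
  rewrite /mode; case: ifP => _; case: ifP => _; rewrite ?lee_fin ?normr_ge0//.
    exact: ler_norm.
  by rewrite vnorm0 expr0n mulr0 normr0.
Qed.

Lemma mode_hnorm_gt0 (m : R) : 0 < hnorm m mode.
Proof.
have [_ _ v0 _] := mode_HH m.
rewrite hnormE// sqrtr_gt0.
apply: lt_le_trans (le_term_rsum _ (HH_summable (mode_HH m)) k0); last first.
  by move=> k; exact: sqr_ge0.
rewrite exprn_gt0// mulr_gt0 ?powR_gt0 ?(lt_le_trans ltr01) ?znorm_ge1//.
apply: le_trans (vnorm_coord _ i0).
by rewrite /mode !inE eqxx /= mxE !eqxx normc1.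
Qed.

(** Testing with a nonzero field in both slots shows that the constants are
    bounded below, without which their infimum would carry no information. *)
Lemma kato_constant_ge0 (p n G : R) : kato_constant d p n G -> 0 <= G.
Proof.
move=> /(_ mode mode (mode_HH p) (mode_HH (p + 1))).
rewrite -normcE_Re => /(le_trans (normc_ge0 _)).
have := mode_hnorm_gt0 p; have := mode_hnorm_gt0 n.
move: (hnorm p mode) (hnorm n mode) => a b b0 a0.
have -> : 1 / 2 * G * (a * b + b * a) * a = (a * b * a) * G by field.
by rewrite pmulr_rge0// !mulr_gt0.
Qed.

End Mode.

(** For fixed fields the inequality is a closed condition on the constant. *)
Lemma kato_constant_inf (p n : R) (S := [set G : R | kato_constant d p n G]) :
  S !=set0 -> has_lbound S -> kato_constant d p n (inf S).
Proof.
move=> S0 lS v w Hv Hw.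
set L := complex.Re _.
set X := (hnorm p v * hnorm n w + hnorm n v * hnorm p w) * hnorm p w.
have X0 : 0 <= X by rewrite mulr_ge0 ?addr_ge0 ?mulr_ge0 ?hnorm_ge0.
have LX G : S G -> L <= 1 / 2 * G * X.
  by move=> SG; have := SG v w Hv Hw; rewrite -/L -mulrA.
rewrite -mulrA -/X; move: X0; rewrite le_eqVlt => /predU1P[X0|X0].
  have [G SG] := S0; have := LX G SG.
  by rewrite -X0 !mulr0.
have : 2 * L / X <= inf S.
  apply: lb_le_inf => // G SG; rewrite ler_pdivrMr//.
  by have := LX G SG; move: (G * X) (mulrA (1/2) G X) => Y <-; lra.
rewrite ler_pdivrMr// -mulrA; move: (inf S * X) => Y; lra.
Qed.

Lemma zeta_gt0 (s : R) : (0 < d)%N -> d%:R < s -> 0 < zeta d s.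
Proof.
move=> d0 ds; rewrite zetaE//.
pose k0 : 'rV[int]_d := delta_mx 0 (Ordinal d0).
have k0_neq0 : k0 != 0.
  apply/eqP => /(congr1 (fun k : 'rV[int]_d => k 0 (Ordinal d0))).
  by rewrite !mxE !eqxx.
apply: lt_le_trans (le_term_rsum (zeta_term_ge0 s) (rsummable_zeta d0 ds) k0).
rewrite /zeta_term (negbTE k0_neq0) invr_gt0 powR_gt0//.
by rewrite (lt_le_trans ltr01)// znorm_ge1.
Qed.

End Sharp.

(** * The limit of the p-th root *)

Section Limit.
Set Implicit Arguments.
Unset Strict Implicit.
Unset Printing Implicit Defensive.
Variable R : realType.

(** From ln p = 2 ln (sqrt p) <= 2 sqrt p, the quotient is O(1 / sqrt p). *)
Lemma ln_affine_div_cvg0 (a : R) : (ln p + a) / p @[p --> +oo] --> (0 : R).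
Proof.
apply/cvgrPdist_le => e e0; near=> p.
pose K := 2 + `|a|.
have K0 : 0 < K by rewrite ltr_pwDl.
have p1 : 1 <= p by near: p; exact: nbhs_pinfty_ge.
have pK : (K / e) ^+ 2 <= p by near: p; apply: nbhs_pinfty_ge; exact: num_real.
have p0 : 0 < p by lra.
have s0 : 0 < Num.sqrt p by rewrite sqrtr_gt0.
have s1 : 1 <= Num.sqrt p by rewrite -sqrtr1 ler_wsqrtr.
have sK : K / e <= Num.sqrt p.
  rewrite -[leLHS]ger0_norm ?divr_ge0 ?(ltW K0) ?(ltW e0)// -sqrtr_sqr ler_wsqrtr//.
have lnp : ln p <= 2 * Num.sqrt p.
  rewrite -{1}(sqr_sqrtr (ltW p0)) lnXn// mulr2n.
  have := ln_sublinear s0; lra.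
have lnp0 : 0 <= ln p by exact: ln_ge0.
rewrite sub0r normrN normrM [`|p^-1|]ger0_norm ?invr_ge0 ?(ltW p0)// ler_pdivrMr//.
apply: (@le_trans _ _ (K * Num.sqrt p)).
  rewrite mulrDl; apply: le_trans (ler_normD _ _) _; rewrite ger0_norm//.
  by rewrite lerD// ler_peMr.
rewrite -{2}(sqr_sqrtr (ltW p0)) expr2 mulrA ler_wpM2r ?(ltW s0)//.
by rewrite -ler_pdivrMl// mulrC.
Unshelve. all: by end_near. Qed.

Lemma powR_root_cvg (c : R) : 0 < c ->
  (2 `^ p * p * c) `^ (1 / p) @[p --> +oo] --> (2 : R).
Proof.
move=> c0.
have lim : expR (ln 2 + (ln p + ln c) / p) @[p --> +oo] --> (2 : R).
  rewrite -{2}(@lnK R 2) ?posrE// -[X in expR X](addr0 (ln 2)).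
  apply: continuous_cvg; first exact: continuous_expR.
  by apply: cvgD; [exact: cvg_cst|exact: ln_affine_div_cvg0].
apply: cvg_trans lim; apply: near_eq_cvg; near=> p.
have p0 : 0 < p by near: p; exact: nbhs_pinfty_gt.
have q0 : 0 < 2 `^ p :> R by exact: powR_gt0.
rewrite /powR gt_eqF; last by rewrite !mulr_gt0// expR_gt0.
rewrite pnatr_eq0/= !lnM ?posrE ?mulr_gt0 ?expR_gt0// expRK.
by congr expR; field; rewrite gt_eqF.
Unshelve. all: by end_near. Qed.

End Limit.

Theorem corollary4p5 (R : realType) (d : nat) (n : R)
    (d_ge2 : (2 <= d)%N) (n_gt : d%:R / 2 + 1 < n) :
  (forall p : R, n <= p ->
     [/\ kato_constant d p n (Gsharp d p n),
         forall G : R, kato_constant d p n G -> Gsharp d p n <= G &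
         Gsharp d p n <= Gplus d p n]) /\
  (Gplus d p n `^ (1 / p) @[p --> +oo] --> (2 : R)).
Proof.
have d_gt0 : (0 < d)%N by exact: leq_trans d_ge2.
split => [p np|].
  have lb : has_lbound [set G : R | kato_constant d p n G].
    exists 0 => G.
    by apply: (@kato_constant_ge0 R d (Ordinal d_gt0) (Ordinal d_ge2)).
  have KG := kato_constant_Gplus d_gt0 n_gt np.
  have inf_le (G : R) : kato_constant d p n G -> Gsharp d p n <= G.
    by move=> ?; exact: ge_inf.
  split => //; last exact: inf_le.
  by apply: kato_constant_inf => //; exists (Gplus d p n).
rewrite /Gplus.
have c0 : 0 < Num.sqrt (zeta d (2 * n - 2)) / (2 * pi) `^ (d%:R / 2).
  rewrite divr_gt0 ?sqrtr_gt0 ?zeta_gt0 ?powR_gt0 ?mulr_gt0 ?pi_gt0//; lra.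
have := powR_root_cvg c0.
by under eq_fun do rewrite mulrA mulrAC.
Qed.
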